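(* Let $3\le d<10$ be an integer and $\gamma\in[1,2)$ with $\gamma<2(d-1)/d$. There exists $C>0$ such that every liquid Lane–Emden star with central density $\rho_0>C$ is linearly unstable against radial perturbations (i.e. there is $\chi\in H^1_r$ with $Q[\chi]<0$, and hence a growing mode exists).
   Context: Fix an integer $d\ge 3$ and $\gamma\in[1,2]$. For $\rho_0>0$, the (radial, gaseous) Lane–Emden profile with central density $\rho_0$ is the unique continuous function $\rho:[0,R_g)\to(0,\infty)$, defined on its maximal interval of existence $[0,R_g)$, $R_g\in(0,\infty]$, with $\rho(0)=\rho_0$ and, writing $m(r)=4\pi\int_0^r y^{d-1}\rho(y)\,dy$, $\frac{d}{dr}\big(\rho(r)^\gamma\big)=-\rho(r)\,m(r)/r^{d-1}$ for $0<r<R_g$ (equivalently: for $\gamma>1$, $w=\rho^{\gamma-1}$ satisfies $w'(r)=-4\pi\frac{\gamma-1}{\gamma}r^{1-d}\int_0^r y^{d-1}w(y)^{\alpha}dy$ with $\alpha=1/(\gamma-1)$; for $\gamma=1$, $h=\ln\rho$ satisfies $h'(r)=-4\pi r^{1-d}\int_0^r y^{d-1}e^{h(y)}dy$). This profile is strictly decreasing and tends to $0$ at the end of its interval of existence. If $\rho_0>1$, let $R$ be the unique radius with $\rho(R)=1$; the liquid Lane–Emden star with central density $\rho_0$ is $\bar\rho=\rho|_{[0,R]}$, with radius $R$ and relative central density $\rho_0-1$. For such a star, let $H^1_r$ be the space of functions $\chi:[0,R]\to\mathbb R$ whose radial extension $x\mapsto\chi(|x|)$ lies in $H^1(B_R)$,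 where $B_R\subset\mathbb R^{d+2}$ is the open ball of radius $R$. Define $L\chi=-\gamma\,(\bar\rho^\gamma y^{d+1}\chi')'+(2(d-1)-d\gamma)\,y^d(\bar\rho^\gamma)'\chi$ and the quadratic form $Q[\chi]=\int_0^R\big[\gamma\bar\rho^\gamma y^{d+1}(\chi')^2+(2(d-1)-d\gamma)y^d\chi^2(\bar\rho^\gamma)'\big]dy+d\gamma R^d\chi(R)^2$ (which equals $\int_0^R (L\chi)\chi\,dy$ for smooth $\chi$ with $d\chi(R)+R\chi'(R)=0$). A growing mode is a pair $(\lambda,\chi)$ with $\lambda>0$, $0\neq\chi\in H^1_r\cap C^2((0,R])$, $L\chi=-\lambda^2y^{d+1}\bar\rho\chi$ on $(0,R]$ and $d\chi(R)+R\chi'(R)=0$; these correspond to solutions $\zeta=e^{\lambda t}\chi(y)$ of the radial Euler–Poisson system (pressure $p=\rho^\gamma-1$) linearised in Lagrangian coordinates about $\bar\rho$, with particle paths $\eta(y,t)=y(1+\zeta(y,t))$. The star is linearly unstable (against radial perturbations) if a growing mode exists, and linearly stable otherwise. *)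

(* Defs.v *)
From HB Require Import structures.
From mathcomp Require Import all_boot all_order all_algebra.
From mathcomp Require Import all_classical all_reals all_analysis.
Set Implicit Arguments. Unset Strict Implicit. Unset Printing Implicit Defensive.
Import Order.TTheory GRing.Theory Num.Theory.
Import numFieldNormedType.Exports.
Local Open Scope classical_set_scope.
Local Open Scope ring_scope.

Section LaneEmden.
Variable R : realType.

Definition LE_mass (d : nat) (rho : R -> R) (r : R) : R :=
  4 * pi * Rintegral lebesgue_measure `[0, r] (fun y => y ^+ (d.-1) * rho y).

Definition LE_profile_on (d : nat) (gamma rho0 : R) (rho : R -> R) (Rg : R) : Prop :=
  [/\ rho 0 = rho0,
      {within `[0, Rg[, continuous rho},
      (forall r, 0 <= r < Rg -> 0 < rho r) &
      (forall r, 0 < r < Rg ->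
         is_derive r 1 (fun y => rho y `^ gamma)
                   (- (rho r * LE_mass d rho r) / r ^+ (d.-1)))].

(* (rho, Rad) is the liquid Lane-Emden star with central density rho0:
   rho is the Lane-Emden profile (on some [0,Rg) with Rad < Rg, which by
   uniqueness agrees with the maximal profile there) and rho(Rad) = 1.
   Only the restriction of rho to [0,Rad] matters below (together with
   two-sided derivatives at Rad, which exist since Rad < Rg). *)
Definition LE_liquid_star (d : nat) (gamma rho0 : R) (rho : R -> R) (Rad : R) : Prop :=
  0 < Rad /\ exists Rg : R, [/\ Rad < Rg, LE_profile_on d gamma rho0 rho Rg & rho Rad = 1].

(* H^1_r membership for a function chi which is C^1 on (0,Rad]:
   the radial extension x |-> chi(|x|) on the ball B_Rad of R^{d+2} is in H^1
   iff chi and its gradient are in L^2, i.e. (polar coordinates, the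
   constant |S^{d+1}| dropped) iff
   \int_0^Rad y^{d+1} (chi^2 + chi'^2) dy < +oo. *)
Definition H1r_of_C1 (d : nat) (Rad : R) (chi : R -> R) : Prop :=
  (\int[@lebesgue_measure R]_(y in [set y : R | (0 < y <= Rad)%R])
      ((y ^+ d.+1 * (chi y ^+ 2 + (derive1 chi y) ^+ 2))%:E) < +oo)%E.

(* chi is C^2 on (0,Rad] (derivatives at Rad are taken two-sided, i.e.
   chi is required to extend C^1-ly a little past Rad, which is no
   restriction since C^2((0,Rad]) functions always extend). *)
Definition C2_on_0R (Rad : R) (chi : R -> R) : Prop :=
  (forall y, 0 < y <= Rad -> derivable chi y 1 /\ derivable (derive1 chi) y 1) /\
  {within `]0, Rad], continuous (derive1 (derive1 chi))}.

Definition LE_L (d : nat) (gamma : R) (rho : R -> R) (chi : R -> R) (y : R) : R :=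
  - gamma * derive1 (fun z => rho z `^ gamma * z ^+ d.+1 * derive1 chi z) y
  + (2 * (d%:R - 1) - d%:R * gamma) * y ^+ d
      * derive1 (fun z => rho z `^ gamma) y * chi y.

Definition growing_mode (d : nat) (gamma : R) (rho : R -> R) (Rad : R)
    (lambda : R) (chi : R -> R) : Prop :=
  0 < lambda /\
  [/\ H1r_of_C1 d Rad chi,
      C2_on_0R Rad chi,
      (exists y, 0 < y <= Rad /\ chi y != 0),
      (forall y, 0 < y <= Rad ->
         LE_L d gamma rho chi y = - lambda ^+ 2 * y ^+ d.+1 * rho y * chi y) &
      d%:R * chi Rad + Rad * derive1 chi Rad = 0].

Definition linearly_unstable (d : nat) (gamma : R) (rho : R -> R) (Rad : R) : Prop :=
  exists lambda chi, growing_mode d gamma rho Rad lambda chi.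

End LaneEmden.

(* Main.v *)
Require Import Defs.
From HB Require Import structures.
From mathcomp Require Import all_boot all_order all_algebra.
From mathcomp Require Import all_classical all_reals all_analysis.
From mathcomp Require Import measurable_realfun.
From mathcomp Require Import ring lra.
Import Order.TTheory GRing.Theory Num.Theory.
Import numFieldNormedType.Exports.
Set Implicit Arguments. Unset Strict Implicit. Unset Printing Implicit Defensive.
Local Open Scope classical_set_scope.
Local Open Scope ring_scope.

(**
Write U = d ln m / d ln r and V = - d ln rho / d ln r, x = 2 / (2 - gamma) and
Us = d - x, so that (Us, x) is the fixed point of the autonomous system for (U, V),
that is, the singular power-law profile.

Differentiating the profile along its scaling family solves the radial equation at
lambda = 0: up to a factor, the solution regular at the centre is chi0 = 1 - Us / U.
It changes sign, or violates the boundary condition on the unstable side, as soon as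
U < Us somewhere in (0, R] or Us V > x U at R.

If neither happens, put a = U - Us, b = V - x and w = b / a. The orbit then stays in the
cone a > 0, -a <= b <= (x / Us) a, and for suitable K, c > 0 the bounded quantity
w - K a increases at a rate at least c V = - c d ln rho / d ln r. This bounds
ln (rho(0) / rho(R)) = ln rho(0). The condition d < 10 makes the quadratic form
governing w at the fixed point positive on the cone.

A growing mode is found by shooting. For large mu = lambda^2 the regular solution is
positive with positive boundary form; for small mu > 0 one of these fails, by continuity
from chi0. At the supremum of the failing values the solution is still positive, by a
Wronskian argument, and its boundary form vanishes.
*)

(** * Calculus on intervals *)

(** The fixed point attracts for [x < (d + 2) / 2] and repels for larger [x], so the long-time
    behaviour of the orbit depends on gamma. The contrapositive treats both ranges at once: without
    a certificate the orbit is confined to a cone, where one monotone quantity bounds the central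
    density in terms of d and gamma alone, with no asymptotics in rho0.

    Origin of [chi0]: the profiles s^x rho(s y) have masses s^(-Us) m(s y), whose s-derivative at s
    = 1 is (U - Us) m. Following shells of fixed enclosed mass gives the relative displacement -(U -
    Us) / U, which is [chi0] up to a factor.

    The centre is a singular point of the radial equation. There chi is followed together with its
    flux gamma rho^gamma y^(d+1) chi', which starts from 0 for the regular solution; the estimates
    of the flux keep a factor y^(d+1) that cancels the singular weight. Shooting produces a C^2 mode
    directly, whereas minimising Q would call for compactness and regularity. *)

Section Calculus.
Variable R : realType.
Implicit Types (f g h F G : R -> R) (A : set R) (x df dg : R).

Lemma is_derive_fadd f g x df dg :
  is_derive x 1 f df -> is_derive x 1 g dg ->
  is_derive x 1 (fun y => f y + g y) (df + dg).
Proof. by move=> hf hg; exact: is_deriveD. Qed.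

Lemma is_derive_fopp f x df :
  is_derive x 1 f df -> is_derive x 1 (fun y => - f y) (- df).
Proof. by move=> hf; exact: is_deriveN. Qed.

Lemma is_derive_fmul f g x df dg :
  is_derive x 1 f df -> is_derive x 1 g dg ->
  is_derive x 1 (fun y => f y * g y) (df * g x + f x * dg).
Proof.
move=> hf hg; have := is_deriveM hf hg => h; apply: is_derive_eq.
by rewrite addrC; congr (_ + _); rewrite /GRing.scale/= mulrC.
Qed.

Lemma is_derive_fexp f n x df :
  is_derive x 1 f df ->
  is_derive x 1 (fun y => f y ^+ n) (n%:R * f x ^+ n.-1 * df).
Proof.
move=> hf; have := @is_deriveX _ _ f n x 1 df hf.
by rewrite (_ : f ^+ n = fun y => f y ^+ n) //; apply/funext => y; rewrite exprfctE.
Qed.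

Lemma is_derive_finv f x df : f x != 0 ->
  is_derive x 1 f df -> is_derive x 1 (fun y => (f y)^-1) (- df / f x ^+ 2).
Proof.
move=> f0 hf; have := is_deriveV f0 hf => h.
by apply: is_derive_eq; rewrite /GRing.scale/= mulNr mulrC mulNr.
Qed.

Lemma is_derive_comp1 f g x a b :
  is_derive (g x) 1 f a -> is_derive x 1 g b ->
  is_derive x 1 (fun y => f (g y)) (a * b).
Proof. by move=> hf hg; exact: is_derive1_comp. Qed.

Lemma is_derive_fexpR f x df :
  is_derive x 1 f df -> is_derive x 1 (fun y => expR (f y)) (expR (f x) * df).
Proof. by move=> hf; apply: is_derive_comp1 hf; exact: is_derive_expR. Qed.

Lemma is_derive_const (c x : R) : is_derive x 1 (fun=> c) 0.
Proof. exact: is_derive_cst. Qed.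

Lemma is_derive_fid (x : R) : is_derive x 1 (fun y : R => y) 1.
Proof. exact: is_derive_id. Qed.

Lemma is_derive_cts f x df : is_derive x 1 f df -> {for x, continuous f}.
Proof.
by move=> [df' _]; apply/differentiable_continuous/derivable1_diffP.
Qed.

Lemma within_add A f g : {within A, continuous f} -> {within A, continuous g} ->
  {within A, continuous (fun y => f y + g y)}.
Proof. exact: within_continuousD. Qed.

Lemma within_sub A f g : {within A, continuous f} -> {within A, continuous g} ->
  {within A, continuous (fun y => f y - g y)}.
Proof. exact: within_continuousB. Qed.

Lemma within_mul A f g : {within A, continuous f} -> {within A, continuous g} ->
  {within A, continuous (fun y => f y * g y)}.
Proof. by move=> cf cg x; apply: cvgM; [exact: cf|exact: cg]. Qed.

Lemma within_comp A f h : continuous h -> {within A, continuous f} ->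
  {within A, continuous (fun y => h (f y))}.
Proof. by move=> ch cf x; apply: cvg_comp; [exact: cf|exact: ch]. Qed.

Lemma within_comp_at A f h : (forall y, A y -> {for f y, continuous h}) ->
  {within A, continuous f} -> {within A, continuous (fun y => h (f y))}.
Proof.
move=> ch /subspace_continuousP cf; apply/subspace_continuousP => y Ay.
by apply: cvg_comp; [exact: cf|exact: ch].
Qed.

Lemma within_exp A f n : {within A, continuous f} ->
  {within A, continuous (fun y => f y ^+ n)}.
Proof. exact: (@within_comp A f (fun z => z ^+ n) (@exprn_continuous _ n)). Qed.

Lemma within_cst A (c : R) : {within A, continuous (fun=> c)}.
Proof. by move=> x; exact: cvg_cst. Qed.

Lemma within_id A : {within A, continuous (fun y : R => y)}.
Proof. by apply: continuous_subspaceT => x; exact: cvg_id. Qed.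

Lemma within_derive (f df : R -> R) (a b : R) :
  (forall y, a <= y <= b -> is_derive y 1 f (df y)) ->
  {within `[a, b], continuous f}.
Proof.
move=> h; have dh : {in `[a, b]%R, forall y, derivable f y 1}.
  by move=> y; rewrite in_itv/= => yab; case: (h y yab).
exact: derivable_within_continuous dh.
Qed.

Lemma le_of_derive (f df : R -> R) (a b : R) : a <= b -> {within `[a, b], continuous f} ->
  (forall y, a < y < b -> is_derive y 1 f (df y)) ->
  (forall y, a < y < b -> 0 <= df y) -> f a <= f b.
Proof.
move=> ab cf hf df0; apply: (@ger0_derive1_le_cc _ f a b) => //.
- by move=> y; rewrite in_itv/= => yab; case: (hf y yab).
- move=> y; rewrite in_itv/= => yab; rewrite derive1E.
  by have hy := hf y yab; rewrite derive_val df0.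
- by rewrite in_itv/= lexx.
- by rewrite in_itv/= lexx andbT.
Qed.

Lemma lt_of_derive (f df : R -> R) (a b : R) : a < b -> {within `[a, b], continuous f} ->
  (forall y, a < y < b -> is_derive y 1 f (df y)) ->
  (forall y, a < y < b -> 0 < df y) -> f a < f b.
Proof.
move=> ab cf hf df0; apply: (@gtr0_derive1_lt_cc _ f a b) => //.
- by move=> y; rewrite in_itv/= => yab; case: (hf y yab).
- move=> y; rewrite in_itv/= => yab; rewrite derive1E.
  by have hy := hf y yab; rewrite derive_val df0.
- by rewrite in_itv/= lexx ltW.
- by rewrite in_itv/= lexx andbT ltW.
Qed.

Lemma norm_le_of_derive F G dF dG (b : R) : 0 <= b ->
  {within `[0, b], continuous F} -> {within `[0, b], continuous G} ->
  F 0 = 0 -> 0 <= G 0 ->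
  (forall y, 0 < y < b -> is_derive y 1 F (dF y)) ->
  (forall y, 0 < y < b -> is_derive y 1 G (dG y)) ->
  (forall y, 0 < y < b -> `|dF y| <= dG y) -> `|F b| <= G b.
Proof.
move=> b0 cF cG F0 G0 hF hG h; rewrite ler_norml; apply/andP; split.
  rewrite lerNl -subr_ge0 opprK; have : G 0 + F 0 <= G b + F b.
    apply: (@le_of_derive (fun y => G y + F y) (fun y => dG y + dF y)) => //.
    - exact: within_add.
    - by move=> y yb; apply: is_derive_fadd; [exact: hG|exact: hF].
    - by move=> y /h; rewrite ler_norml => /andP[+ _]; rewrite lerNl -subr_ge0 opprK.
  by apply: le_trans; rewrite F0 addr0.
rewrite -subr_ge0; have : G 0 - F 0 <= G b - F b.
  apply: (@le_of_derive (fun y => G y - F y) (fun y => dG y - dF y)) => //.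
  - exact: within_sub.
  - move=> y yb; apply: is_derive_fadd; first exact: hG.
    by apply: is_derive_fopp; exact: hF.
  - by move=> y /h; rewrite ler_norml => /andP[_]; rewrite -subr_ge0.
by apply: le_trans; rewrite F0 subr0.
Qed.

(* A maximum point of [f] on [a, b] other than [b] has nonpositive derivative. *)
Lemma stays_above (f df : R -> R) (a b c : R) : a <= b ->
  (forall y, a <= y <= b -> is_derive y 1 f (df y)) ->
  (forall y, a <= y <= b -> c < f y -> 0 < df y) -> c < f a -> c < f b.
Proof.
move=> ab hf h ca.
have [//|fb] := ltP c (f b).
have [s] := EVT_max ab (within_derive hf); rewrite in_itv/= => sab smax.
have cs : c < f s.
  by apply: lt_le_trans ca _; apply: smax; rewrite in_itv/= lexx ab.
have {}sb : s < b.
  have /andP[_] := sab; rewrite le_eqVlt => /predU1P[sb|//].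
  by move: cs; rewrite sb ltNge fb.
have /andP[as_ _] := sab.
have d0 := h s sab cs.
(* The maximum [s] may be the left end [a], where the derivative need not vanish. The slope function
   shows growth just to the right of [s], a contradiction in either case. *)
have [g [fg cg gs]] := (is_derive1_caratheodory f s (df s)).1 (hf s sab).
have g0 : \forall z \near s^'+, 0 < g z.
  apply: (@cvgr_gt _ _ _ _ g (df s) _ 0 d0).
  by rewrite -gs; apply: cvg_at_right_filter; exact: cg.
have : \forall z \near s^'+, False.
  near=> z.
  have sz : s < z by near: z; exact: nbhs_right_gt.
  have zb : z < b by near: z; exact: nbhs_right_lt.
  have gz : 0 < g z by near: z; exact: g0.
  have : f z <= f s.
    by apply: smax; rewrite in_itv/= (ltW zb) andbT (le_trans as_)// ltW.
  by rewrite -subr_le0 fg pmulr_rle0// subr_le0 leNgt sz.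
by move=> /filter_ex[].
Unshelve. all: by end_near. Qed.

(* The backward form: a negative excursion would have to come from the left end. *)
Lemma stays_below (f df : R -> R) (a b c : R) : a <= b ->
  (forall y, a <= y <= b -> is_derive y 1 f (df y)) ->
  (forall y, a <= y <= b -> f y < c -> 0 < df y) -> f b < c -> f a < c.
Proof.
move=> ab hf h fb.
have := @stays_above (fun y => - f (- y)) (fun y => df (- y)) (- b) (- a) (- c).
rewrite !opprK !ltrN2; apply => //; first by rewrite lerN2.
  move=> y yab; have yab' : a <= - y <= b by rewrite lerNr lerNl andbC.
  have h1 := hf _ yab'.
  have h2 := is_derive_comp1 h1 (is_derive_fopp (is_derive_fid y)).
  have h3 := is_derive_fopp h2.
  by apply: is_derive_eq; rewrite mulrN1 opprK.
move=> y yab; rewrite ltrN2; apply: h.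
by rewrite lerNr lerNl andbC.
Qed.

Lemma within_near0 f (Y : R) (P : set R) : 0 < Y -> {within `[0, Y], continuous f} ->
  open P -> P (f 0) -> exists2 s, 0 < s <= Y & forall z, 0 < z < s -> P (f z).
Proof.
move=> Y0 cf oP Pf.
have [_ f0 _] := (continuous_within_itvP f Y0).1 cf.
have : \forall z \near 0^'+, P (f z) by apply: f0; exact: open_nbhs_nbhs.
case=> e /= e0 he; exists (Num.min e Y).
  by rewrite lt_min e0 Y0 ge_min lexx orbT.
move=> z /andP[z0]; rewrite lt_min => /andP[ze _]; apply: he => //=.
by rewrite sub0r normrN gtr0_norm.
Qed.

Lemma within_bounded f (Y : R) : 0 <= Y -> {within `[0, Y], continuous f} ->
  exists2 M : R, 0 <= M & forall y, 0 <= y <= Y -> `|f y| <= M.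
Proof.
move=> Y0 cf; have cnf : {within `[0, Y], continuous (fun y => `|f y|)}.
  exact: (@within_comp _ f (fun z : R => `|z|) (@norm_continuous _ R)).
have [c _ hc] := EVT_max Y0 cnf.
by exists `|f c| => // y yY; apply: hc; rewrite in_itv.
Qed.

(** For functions given by a formula that is meaningful only for y > 0: [g] supplies the limit at
    the centre. *)
Lemma within_squeeze0 f g (Y : R) : 0 < Y ->
  (forall y, 0 < y <= Y -> {for y, continuous f}) ->
  {within `[0, Y], continuous g} -> g 0 = 0 ->
  (forall y, 0 < y <= Y -> `|f y - f 0| <= g y) ->
  {within `[0, Y], continuous f}.
Proof.
move=> Y0 cf cg g0 h; apply/continuous_within_itvP => //; split.
- by move=> y; rewrite in_itv/= => /andP[y0 /ltW yY]; apply: cf; rewrite y0.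
- apply/cvgrPdist_lt => e e0; have [|s /andP[s0 sY] hs] := within_near0 Y0 cg (@open_lt R e).
    by rewrite /= g0.
  near=> y; rewrite distrC; apply: le_lt_trans (h y _) (hs y _).
    apply/andP; split; first by near: y; exact: nbhs_right_gt.
    by apply: le_trans sY; near: y; exact: nbhs_right_le.
  apply/andP; split; first by near: y; exact: nbhs_right_gt.
  by near: y; exact: nbhs_right_lt.
- by apply: cvg_at_left_filter; apply: cf; rewrite Y0 lexx.
Unshelve. all: by end_near. Qed.

End Calculus.

(** * Primitives vanishing at the origin *)

Section Primitive.
Variable R : realType.
Implicit Types (f g : R -> R).

Definition prim f (r : R) : R := Rintegral lebesgue_measure `[0, r] f.

Lemma prim0 f : prim f 0 = 0.
Proof. by rewrite /prim set_itv1 Rintegral_set1. Qed.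

Lemma prim_cts f (Y : R) : 0 < Y -> {within `[0, Y], continuous f} ->
  {within `[0, Y], continuous (prim f)}.
Proof.
move=> Y0 cf; apply: (@parameterized_integral_continuous R 0 Y f (ltW Y0)).
by apply: continuous_compact_integrable => //; exact: segment_compact.
Qed.

Lemma is_derive_prim f (Y : R) : {within `[0, Y], continuous f} ->
  forall y, 0 < y < Y -> is_derive y 1 (prim f) (f y).
Proof.
move=> cf y /andP[y0 yY].
have fi : lebesgue_measure.-integrable `[0, Y] (EFin \o f).
  by apply: continuous_compact_integrable => //; exact: segment_compact.
have cy : {for y, continuous f}.
  apply: (@within_continuous_continuous _ _ _ 0 Y) => //.
    exact: lt_trans yY.
  by rewrite in_itv/= y0 yY.
have [d1 d2] := @continuous_FTC1_closed R f 0 y Y yY fi y0 cy.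
by apply: DeriveDef d1 _; rewrite -derive1E.
Qed.

Lemma prim_ge0 f (Y : R) : (forall y, 0 <= y <= Y -> 0 <= f y) -> 0 <= prim f Y.
Proof. by move=> f0; apply: Rintegral_ge0 => x; rewrite /= in_itv/= => /f0. Qed.

End Primitive.

(** * Limits with a geometric rate *)

Section Limits.
Variable R : realType.

Lemma le_of_half_powers (a b C : R) :
  (forall n : nat, a <= b + C * 2^-1 ^+ n) -> a <= b.
Proof.
move=> h; rewrite leNgt; apply/negP => ba.
have cv : (fun n : nat => b + C * 2^-1 ^+ n) @ \oo --> b + C * 0.
  apply: cvgD; first exact: cvg_cst.
  apply: cvgM; first exact: cvg_cst.
  by apply: cvg_expr; rewrite gtr0_norm ?invr_gt0// invf_lt1// ltr1n.
rewrite mulr0 addr0 in cv.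
have /cvgr_lt /(_ a ba) [N _ hN] := cv.
by have := hN N (leqnn N); rewrite ltNge h.
Qed.

(** Nested intervals: with radius [E * 2 * 2^-1 ^+ n] around [u n], a step of size [E * 2^-1 ^+ n]
    is exactly the loss of radius. *)
Lemma geometric_limit (u : nat -> R) (E : R) :
  (forall n, `|u n.+1 - u n| <= E * 2^-1 ^+ n) ->
  exists l, forall n, `|l - u n| <= E * 2 * 2^-1 ^+ n.
Proof.
move=> h.
pose a n := u n - E * 2 * 2^-1 ^+ n; pose b n := u n + E * 2 * 2^-1 ^+ n.
have E0 : 0 <= E by have := h 0%N; rewrite expr0 mulr1; apply: le_trans.
have half (n : nat) : 0 <= 2^-1 ^+ n :> R by rewrite exprn_ge0.
have aS n : a n <= a n.+1.
  have := h n; rewrite ler_norml /a exprS => /andP[h1 h2]; lra.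
have bS n : b n.+1 <= b n.
  have := h n; rewrite ler_norml /b exprS => /andP[h1 h2]; lra.
have ndec m n : (m <= n)%N -> a m <= a n.
  by move=> mn; apply: (homo_leq (r := fun x y : R => x <= y)) mn => //; exact: le_trans.
have ninc m n : (m <= n)%N -> b n <= b m.
  move=> mn; apply: (homo_leq (r := fun x y : R => y <= x)) mn => //.
  by move=> y x z xy yz; exact: le_trans yz xy.
have ab m n : a m <= b n.
  have := ndec m (maxn m n) (leq_maxl _ _); have := ninc n (maxn m n) (leq_maxr _ _).
  move=> h1 h2; apply: le_trans h2 (le_trans _ h1).
  have := half (maxn m n) => hh.
  have : 0 <= E * 2 * 2^-1 ^+ (maxn m n) by rewrite !mulr_ge0.
  by rewrite /a /b; lra.
have hs : has_sup (range a).
  split; first by exists (a 0%N), 0%N.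
  by exists (b 0%N) => _ [m _ <-]; exact: ab.
exists (sup (range a)) => n.
have l1 : a n <= sup (range a) by apply: sup_upper_bound => //; exists n.
have l2 : sup (range a) <= b n.
  by apply: ge_sup; [case: hs|move=> _ [m _ <-]; exact: ab].
rewrite ler_norml; move: l1 l2; rewrite /a /b => l1 l2; apply/andP; split; lra.
Qed.

Lemma within_uniform_limit (A : set R) (S : nat -> R -> R) (f : R -> R) (E : R) :
  (forall n, {within A, continuous (S n)}) ->
  (forall n y, A y -> `|f y - S n y| <= E * 2^-1 ^+ n) ->
  {within A, continuous f}.
Proof.
move=> cS h; have E0 : A !=set0 -> 0 <= E.
  by move=> [y Ay]; have := h 0%N y Ay; rewrite expr0 mulr1; apply: le_trans.
apply/subspace_continuousP => x Ax.
have {}E0 : 0 <= E by apply: E0; exists x.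
apply/cvgrPdist_le => /= e e0.
have [n hn] : exists n, E * 2^-1 ^+ n <= e / 3.
  apply: contrapT => hN.
  have : e / 3 <= 0.
    apply: (@le_of_half_powers _ _ E) => n; rewrite add0r leNgt; apply/negP => hl.
    by apply: hN; exists n; exact: ltW.
  by rewrite leNgt divr_gt0.
have /cvgrPdist_le /(_ (e / 3)) := (subspace_continuousP A (S n)).1 (cS n) x Ax.
rewrite divr_gt0// => /(_ isT) hSn.
have hA : \forall y \near within A (nbhs x), A y by exact: withinT.
near=> y.
have Ay : A y by near: y.
have h1 := h n x Ax; have h2 := h n y Ay.
have h3 : `|S n x - S n y| <= e / 3 by near: y.
rewrite (_ : f x - f y = (f x - S n x) + (S n x - S n y) - (f y - S n y)); last by ring.
apply: (le_trans (ler_normB _ _)).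
rewrite -[X in _ <= X](_ : (e / 3 + e / 3) + e / 3 = e); last by field.
apply: lerD; last exact: le_trans hn.
by apply: (le_trans (ler_normD _ _)); apply: lerD => //; exact: le_trans hn.
Unshelve. all: by end_near. Qed.

End Limits.

(** * The regular solution of a radial equation *)

Section RadialSystem.
Variables (R : realType) (n : nat) (Y p0 Q : R) (p : R -> R).
Implicit Types (k f g F G om : R -> R) (y z w : R).
Hypotheses (Y0 : 0 < Y) (p0_gt0 : 0 < p0) (Q0 : 0 <= Q).
Hypothesis p_cts : {within `[0, Y], continuous p}.
Hypothesis p_ge : forall y, 0 <= y <= Y -> p0 <= p y.

Lemma within_le f (y : R) : y <= Y -> {within `[0, Y], continuous f} ->
  {within `[0, y], continuous f}.
Proof.
move=> yY; apply: continuous_subspaceW => z /=; rewrite !in_itv/= => /andP[-> zy].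
exact: le_trans yY.
Qed.

(* With this weight the Volterra operator of the system is a contraction. *)
Definition rate : R := 1 + 2 * Q / p0.

Lemma rate_ge1 : 1 <= rate.
Proof. by rewrite lerDl divr_ge0 ?mulr_ge0 // ltW. Qed.

Lemma rate_geQ : Q <= rate * p0 / 2.
Proof.
rewrite (_ : rate * p0 / 2 = p0 / 2 + Q); last by rewrite /rate; field; exact: lt0r_neq0.
by rewrite lerDr divr_ge0 // ltW.
Qed.

(** Comparison with the right-hand side, whose derivative is large enough even without the term that
    comes from [y ^+ n]. That factor is kept because it cancels the weight dividing [om] in the
    equation for chi'. *)
Lemma flux_bound om g (D e : R) : 0 <= D -> 0 <= e ->
  {within `[0, Y], continuous om} -> om 0 = 0 ->
  (forall y, 0 < y < Y -> is_derive y 1 om (g y)) ->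
  (forall y, 0 < y < Y -> `|g y| <= y ^+ n * (Q * D * expR (rate * y) + e)) ->
  forall y, 0 <= y <= Y ->
    `|om y| <= y ^+ n * (D * p0 / 2 * expR (rate * y) + e * y).
Proof.
move=> D0 e0 com om0 hom hg y /andP[y0 yY].
have gty z : 0 < z < y -> 0 < z < Y.
  by move=> /andP[-> zy]; exact: lt_le_trans yY.
pose B z := D * p0 / 2 * expR (rate * z) + e * z.
pose dB z := D * p0 / 2 * (expR (rate * z) * rate) + e.
have hB z : is_derive z 1 B (dB z).
  have h1 := is_derive_fmul (is_derive_const rate z) (is_derive_fid z).
  have h2 := is_derive_fmul (is_derive_const (D * p0 / 2) z) (is_derive_fexpR h1).
  have h3 := is_derive_fmul (is_derive_const e z) (is_derive_fid z).
  by have h4 := is_derive_fadd h2 h3; apply: is_derive_eq; rewrite /dB; ring.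
have B_ge0 z : 0 <= z -> 0 <= B z.
  by move=> z0; rewrite /B addr_ge0 ?mulr_ge0 ?expR_ge0// ltW.
have hG z := is_derive_fmul (is_derive_fexp n (is_derive_fid z)) (hB z).
apply: (@norm_le_of_derive R om (fun z => z ^+ n * B z) g
  (fun z => n%:R * z ^+ n.-1 * 1 * B z + z ^+ n * dB z)) => //.
- exact: within_le com.
- by apply: within_derive => z _; exact: hG.
- by apply: mulr_ge0; [exact: exprn_ge0|exact: B_ge0].
- by move=> z /gty; exact: hom.
- move=> z zy; have /andP[z0 _] := zy; apply: le_trans (hg z (gty _ zy)) _.
  apply: le_trans (_ : z ^+ n * dB z <= _); last first.
    rewrite lerDr mulr1; apply: mulr_ge0; last exact/B_ge0/ltW.
    by apply: mulr_ge0 => //; apply/exprn_ge0/ltW.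
  apply: ler_wpM2l; first exact/exprn_ge0/ltW.
  rewrite /dB lerD2r.
  have -> : D * p0 / 2 * (expR (rate * z) * rate) =
    rate * p0 / 2 * (D * expR (rate * z)) by ring.
  by rewrite -mulrA ler_wpM2r ?rate_geQ// mulr_ge0// expR_ge0.
Qed.

(** [D] is a weighted sup norm of the argument of the Volterra operator and [e] a source. The factor
    1/2 is the contraction behind the Picard iteration; the other term serves the dependence on the
    coefficient. *)
Lemma volterra_bound F om g (D e : R) : 0 <= D -> 0 <= e ->
  {within `[0, Y], continuous F} -> {within `[0, Y], continuous om} ->
  F 0 = 0 -> om 0 = 0 ->
  (forall y, 0 < y < Y -> is_derive y 1 F (om y / (p y * y ^+ n))) ->
  (forall y, 0 < y < Y -> is_derive y 1 om (g y)) ->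
  (forall y, 0 < y < Y -> `|g y| <= y ^+ n * (Q * D * expR (rate * y) + e)) ->
  forall y, 0 <= y <= Y -> `|F y| <= D / 2 * expR (rate * y) + e / p0 * y ^+ 2.
Proof.
move=> D0 e0 cF com F0 om0 hF hom hg y /andP[y0 yY].
have hom' := flux_bound D0 e0 com om0 hom hg.
have gty z : 0 < z < y -> 0 < z < Y.
  by move=> /andP[-> zy]; exact: lt_le_trans yY.
have hG z : is_derive z 1 (fun z => D / 2 * expR (rate * z) + e / p0 * z ^+ 2)
    (D / 2 * (expR (rate * z) * rate) + e / p0 * (2 * z)).
  have h1 := is_derive_fmul (is_derive_const rate z) (is_derive_fid z).
  have h2 := is_derive_fmul (is_derive_const (D / 2) z) (is_derive_fexpR h1).
  have h3 := is_derive_fmul (is_derive_const (e / p0) z) (is_derive_fexp 2 (is_derive_fid z)).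
  by have h4 := is_derive_fadd h2 h3; apply: is_derive_eq => /=; ring.
apply: (norm_le_of_derive (F := F) y0 _ _ F0 _ _ (fun z _ => hG z)).
- exact: within_le cF.
- by apply: within_derive => z _; exact: hG.
- by rewrite addr_ge0// mulr_ge0// ?expR_ge0 ?divr_ge0// ltW.
- by move=> z /gty; exact: hF.
- move=> z zy; have /andP[z0 zY] := gty _ zy.
  have zcc : 0 <= z <= Y by rewrite !ltW.
  have pz : 0 < p z by apply: lt_le_trans (p_ge zcc).
  have zn : 0 < z ^+ n by rewrite exprn_gt0.
  rewrite normrM normfV (gtr0_norm (mulr_gt0 pz zn)) ler_pdivrMr ?mulr_gt0//.
  apply: le_trans (hom' z zcc) _.
  rewrite [X in X <= _]mulrC [X in _ <= X]mulrA; apply: ler_wpM2r; first exact: ltW.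
  set E := expR _; have E0 : 0 <= E by exact: expR_ge0.
  apply: le_trans (_ : (D / 2 * (E * rate) + e / p0 * (2 * z)) * p0 <= _); last first.
    apply: ler_wpM2l; last exact: p_ge.
    have r0 : 0 <= rate by exact: le_trans rate_ge1.
    have ep : 0 <= e / p0 by rewrite divr_ge0// ltW.
    apply: addr_ge0; first by apply: mulr_ge0; [exact: divr_ge0|exact: mulr_ge0].
    by apply: mulr_ge0 => //; apply: mulr_ge0 => //; exact: ltW.
  rewrite (_ : (_ + _) * p0 = D * p0 / 2 * E * rate + e * z + e * z); last first.
    by field; exact: lt0r_neq0.
  rewrite -addrA lerD//; last by rewrite lerDl mulr_ge0// ltW.
  by rewrite ler_peMr ?rate_ge1// !mulr_ge0// ltW.
Qed.

(* Flux formulation of the radial equation [(p y^n chi')' = k chi], which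
   encodes regularity at the origin as [om 0 = 0]. *)
Definition radial_sol k (c0 : R) (chi om : R -> R) : Prop :=
  [/\ {within `[0, Y], continuous chi} /\ {within `[0, Y], continuous om},
      chi 0 = c0 /\ om 0 = 0,
      forall y, 0 < y < Y -> is_derive y 1 chi (om y / (p y * y ^+ n)) &
      forall y, 0 < y < Y -> is_derive y 1 om (k y * chi y)].

(** * Picard iteration for the regular solution *)

Section Existence.
Variable k : R -> R.
Hypothesis k_cts : {within `[0, Y], continuous k}.
Hypothesis k_le : forall y, 0 <= y <= Y -> `|k y| <= Q * y ^+ n.

Definition flux f := prim (fun z => k z * f z).
Definition volterra f := prim (fun z => flux f z / (p z * z ^+ n)).

Lemma flux_cts f : {within `[0, Y], continuous f} ->
  {within `[0, Y], continuous (flux f)}.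
Proof. by move=> cf; apply: prim_cts => //; exact: within_mul. Qed.

Lemma is_derive_flux f : {within `[0, Y], continuous f} ->
  forall y, 0 < y < Y -> is_derive y 1 (flux f) (k y * f y).
Proof.
move=> cf; apply: (@is_derive_prim R (fun z => k z * f z)); exact: within_mul.
Qed.

Lemma slope_cts f : {within `[0, Y], continuous f} ->
  {within `[0, Y], continuous (fun z => flux f z / (p z * z ^+ n))}.
Proof.
move=> cf; apply/continuous_within_itvP => //.
have cfl := flux_cts cf.
have nz y : 0 < y <= Y -> p y * y ^+ n != 0.
  move=> /andP[y0 yY]; rewrite lt0r_neq0// mulr_gt0 ?exprn_gt0//.
  by apply: lt_le_trans (p_ge _) => //; rewrite yY ltW.
have /continuous_within_itvP -/(_ Y0)[p1 p2 p3] := p_cts.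
have /continuous_within_itvP -/(_ Y0)[f1 f2 f3] := cfl.
split.
- move=> y /[dup] yI; rewrite in_itv/= => /andP[y0 yY].
  apply: cvgM; first exact: f1.
  apply: cvgV; first by apply: nz; rewrite y0 ltW.
  by apply: cvgM; [exact: p1|exact: exprn_continuous].
(* The quotient is 0 at the centre because its numerator is. [flux_bound] with [D = 0], all of [k f]
   being counted as source, makes it O(y). *)
- have [M M0 hM] := within_bounded (ltW Y0) cf.
  have hfl y : 0 <= y <= Y -> `|flux f y| <= y ^+ n * (Q * M * y).
    move=> yY; have := @flux_bound (flux f) (fun z => k z * f z) 0 (Q * M).
    move=> /(_ (lexx _) (mulr_ge0 Q0 M0) cfl (prim0 _) (is_derive_flux cf)) H.
    have := H _ y yY; rewrite !mul0r add0r; apply.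
    move=> z /andP[z0 zY]; rewrite mulr0 mul0r add0r normrM mulrA [_ * Q]mulrC.
    by apply: ler_pM => //; [apply: k_le|apply: hM]; rewrite !ltW.
  rewrite [flux f 0]prim0 mul0r; apply/cvgr0Pnorm_le => e e0.
  near=> y.
  have y0 : 0 < y by near: y; exact: nbhs_right_gt.
  have yY : y < Y by near: y; exact: nbhs_right_lt.
  have yQ : y < e * p0 / (Q * M + 1).
    near: y; apply: nbhs_right_lt; rewrite divr_gt0// ?mulr_gt0//.
    by rewrite ltr_wpDl// mulr_ge0.
  have ycc : 0 <= y <= Y by rewrite !ltW.
  have py : 0 < p y by apply: lt_le_trans (p_ge ycc).
  have yn : 0 < y ^+ n by rewrite exprn_gt0.
  rewrite normrM normfV (gtr0_norm (mulr_gt0 py yn)) ler_pdivrMr ?mulr_gt0//.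
  apply: le_trans (hfl y ycc) _.
  rewrite [X in X <= _]mulrC [X in _ <= X]mulrA; apply: ler_wpM2r; first exact: ltW.
  have QM : 0 < Q * M + 1 by rewrite ltr_wpDl// mulr_ge0.
  move: yQ; rewrite ltr_pdivlMr// => yQ.
  apply: le_trans (_ : e * p0 <= _); last by apply: ler_wpM2l; [exact: ltW|exact: p_ge].
  by apply: le_trans (ltW yQ); rewrite mulrDr mulr1 mulrC lerDl ltW.
- apply: cvgM => //; apply: cvgV; first by apply: nz; rewrite Y0 lexx.
  apply: cvgM => //; apply: cvg_at_left_filter; exact: exprn_continuous.
Unshelve. all: by end_near. Qed.

Lemma volterra_cts f : {within `[0, Y], continuous f} ->
  {within `[0, Y], continuous (volterra f)}.
Proof. by move=> cf; apply: prim_cts => //; exact: slope_cts. Qed.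

Lemma is_derive_volterra f : {within `[0, Y], continuous f} ->
  forall y, 0 < y < Y -> is_derive y 1 (volterra f) (flux f y / (p y * y ^+ n)).
Proof. by move=> cf; apply: is_derive_prim; exact: slope_cts. Qed.

Lemma volterra_lip f g (D : R) : 0 <= D ->
  {within `[0, Y], continuous f} -> {within `[0, Y], continuous g} ->
  (forall y, 0 <= y <= Y -> `|f y - g y| <= D * expR (rate * y)) ->
  forall y, 0 <= y <= Y ->
    `|volterra f y - volterra g y| <= D / 2 * expR (rate * y).
Proof.
move=> D0 cf cg h y yY.
have := @volterra_bound (fun y => volterra f y - volterra g y)
  (fun y => flux f y - flux g y) (fun y => k y * f y - k y * g y) D 0 D0 (lexx _).
rewrite mul0r; move=> /(_ _ _ _ _ _ _ _ y yY); rewrite mul0r addr0; apply.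
- by apply: within_sub; exact: volterra_cts.
- by apply: within_sub; exact: flux_cts.
- by rewrite /volterra !prim0 subrr.
- by rewrite /flux !prim0 subrr.
- move=> z zY; rewrite mulrBl; apply: is_derive_fadd; first exact: is_derive_volterra.
  by apply: is_derive_fopp; exact: is_derive_volterra.
- move=> z zY; apply: is_derive_fadd; first exact: is_derive_flux.
  by apply: is_derive_fopp; exact: is_derive_flux.
- move=> z /andP[z0 zY]; have zcc : 0 <= z <= Y by rewrite !ltW.
  rewrite addr0 -mulrBr normrM -[Q * D * _]mulrA mulrA [_ * Q]mulrC.
  by apply: ler_pM => //; [exact: k_le|exact: h].
Qed.

Fixpoint picard (N : nat) : R -> R :=
  if N is N'.+1 then fun y => 1 + volterra (picard N') y else fun=> 1.

Lemma picard_cts N : {within `[0, Y], continuous (picard N)}.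
Proof.
elim: N => [|N IH] /=; first exact: within_cst.
by apply: within_add; [exact: within_cst|exact: volterra_cts].
Qed.

Lemma picard_step : exists2 D, 0 <= D & forall N y, 0 <= y <= Y ->
  `|picard N.+1 y - picard N y| <= D * 2^-1 ^+ N * expR (rate * y).
Proof.
have [D D0 hD] := within_bounded (ltW Y0) (volterra_cts (@within_cst R _ 1)).
exists D => //; elim=> [|N IH] y yY.
  rewrite /= expr0 mulr1 addrAC subrr add0r.
  apply: (le_trans (hD y yY)).
  rewrite ler_peMr// -[X in X <= _]expR0 ler_expR mulr_ge0//.
    by apply: le_trans rate_ge1.
  by case/andP: yY.
rewrite (_ : _ - _ = volterra (picard N.+1) y - volterra (picard N) y); last first.
  by rewrite [LHS]/= opprD addrACA subrr add0r.
rewrite exprSr mulrA.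
have DN : 0 <= D * 2^-1 ^+ N by rewrite mulr_ge0// exprn_ge0.
have H := volterra_lip DN (@picard_cts N.+1) (@picard_cts N) IH.
exact: H yY.
Qed.

(** The last clause is proved here because it passes through the Picard iterates: each is 1 plus the
    Volterra image of a nonnegative function. *)
Lemma radial_sol_exists : exists chi om, radial_sol k 1 chi om /\
  ((forall y, 0 <= y <= Y -> 0 <= k y) -> forall y, 0 <= y <= Y -> 1 <= chi y).
Proof.
have [D D0 hD] := picard_step.
pose EY := expR (rate * Y).
have r0 : 0 <= rate by apply: le_trans rate_ge1.
have hEY y : 0 <= y <= Y -> expR (rate * y) <= EY.
  by move=> /andP[_ yY]; rewrite ler_expR ler_wpM2l.
(* The interval is a premise under the existential, so that a limit can be chosen for every real
   [y]. *)
have lim y : exists l, 0 <= y <= Y ->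
    forall N, `|l - picard N y| <= D * expR (rate * y) * 2 * 2^-1 ^+ N.
  have [yY|_] := boolP (0 <= y <= Y); last by exists 0.
  have [N|l hl] := @geometric_limit R (fun N => picard N y) (D * expR (rate * y)).
    by apply: le_trans (hD N y yY) _; rewrite mulrAC.
  by exists l.
pose f y := sval (cid (lim y)).
have hf y : 0 <= y <= Y ->
    forall N, `|f y - picard N y| <= D * expR (rate * y) * 2 * 2^-1 ^+ N.
  exact: (svalP (cid (lim y))).
have cf : {within `[0, Y], continuous f}.
  apply: (@within_uniform_limit R _ picard _ (D * EY * 2)) => [N|N y]; first exact: picard_cts.
  rewrite /= in_itv/= => yY; apply: le_trans (hf y yY N) _.
  apply: ler_wpM2r; first exact: exprn_ge0.
  by apply: ler_wpM2r => //; apply: ler_wpM2l => //; exact: hEY.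
have fixf y : 0 <= y <= Y -> f y = 1 + volterra f y.
  move=> yY; apply/eqP; rewrite -subr_eq0 -normr_le0.
  apply: (@le_of_half_powers R _ _ (D * EY * 2)) => N; rewrite add0r.
  rewrite (_ : f y - _ = (f y - picard N.+1 y) + (volterra (picard N) y - volterra f y)); last first.
    rewrite -[picard N.+1 y]/(1 + volterra (picard N) y).
    by move: (f y) (volterra _ y) (volterra f y) => u v w; ring.
  have h1 := hf y yY N.+1.
  have h2 : `|volterra (picard N) y - volterra f y| <=
      D * 2 * 2^-1 ^+ N / 2 * expR (rate * y).
    apply: volterra_lip => //.
    - by apply: mulr_ge0; [exact: mulr_ge0|exact: exprn_ge0].
    - exact: picard_cts.
    - move=> z zY; rewrite distrC; apply: le_trans (hf z zY N) _.
      by rewrite le_eqVlt; apply/orP; left; apply/eqP; ring.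
  apply: le_trans (ler_normD _ _) _; apply: le_trans (lerD h1 h2) _.
  rewrite exprS.
  rewrite [X in X <= _](_ : _ = D * 2 * 2^-1 ^+ N * expR (rate * y)); last by field.
  rewrite [X in _ <= X](_ : _ = D * 2 * 2^-1 ^+ N * EY); last by ring.
  apply: ler_wpM2l; last exact: hEY.
  by apply: mulr_ge0; [exact: mulr_ge0|exact: exprn_ge0].
exists (fun y => 1 + volterra f y), (flux f); split; last first.
  move=> k0 y yY.
  have vp g z : 0 <= z <= Y -> (forall y, 0 <= y <= Y -> 0 <= g y) -> 0 <= volterra g z.
    move=> /andP[_ zY] g0; apply: prim_ge0 => w /andP[w0 wz].
    have wY : 0 <= w <= Y by rewrite w0 (le_trans wz).
    apply: divr_ge0; last first.
      by rewrite mulr_ge0 ?exprn_ge0//; apply: le_trans (p_ge wY); exact: ltW.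
    apply: prim_ge0 => v /andP[v0 vw].
    have vY : 0 <= v <= Y by rewrite v0 (le_trans vw)//; case/andP: wY.
    by rewrite mulr_ge0 ?k0 ?g0.
  have pic N : forall z, 0 <= z <= Y -> 1 <= picard N z.
    elim: N => [|N IH] z zY //=; rewrite lerDl; apply: vp => // w wY.
    by apply: le_trans (IH w wY).
  rewrite -fixf//; apply: (@le_of_half_powers R _ _ (D * expR (rate * y) * 2)) => N.
  have := hf y yY N; rewrite ler_norml => /andP[h _]; have := pic N y yY; lra.
split.
- by split; [apply: within_add; [exact: within_cst|exact: volterra_cts]|exact: flux_cts].
- by rewrite /volterra /flux !prim0 addr0.
- move=> y yY; rewrite -[X in is_derive _ _ _ X]add0r.
  exact: (is_derive_fadd (is_derive_const 1 y) (is_derive_volterra cf yY)).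
- move=> y /andP[y0 yY]; rewrite -fixf ?(ltW y0) ?(ltW yY)//.
  by apply: is_derive_flux => //; rewrite y0.
Qed.

End Existence.
End RadialSystem.

(** * Shooting *)

Section Stability.
Variables (R : realType) (n : nat) (Y p0 Q : R) (p : R -> R).
Implicit Types (k e F G om chi : R -> R) (y z w : R).
Hypotheses (Y0 : 0 < Y) (p0_gt0 : 0 < p0) (Q0 : 0 <= Q).
Hypothesis p_ge : forall y, 0 <= y <= Y -> p0 <= p y.

(** [F] and [om] stand for the difference of two solutions, [e] for the defect caused by a change of
    coefficient. [C] is uniform in [k], so it serves all spectral parameters at once; [eps = 0]
    contains uniqueness. *)
Lemma radial_stability : exists2 C : R, 0 < C &
  forall k e F om (eps : R), 0 <= eps ->
  (forall y, 0 <= y <= Y -> `|k y| <= Q * y ^+ n) ->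
  (forall y, 0 < y < Y -> `|e y| <= eps * y ^+ n) ->
  {within `[0, Y], continuous F} -> {within `[0, Y], continuous om} ->
  F 0 = 0 -> om 0 = 0 ->
  (forall y, 0 < y < Y -> is_derive y 1 F (om y / (p y * y ^+ n))) ->
  (forall y, 0 < y < Y -> is_derive y 1 om (k y * F y + e y)) ->
  forall y, 0 <= y <= Y -> `|F y| <= C * eps /\ `|om y| <= C * eps.
Proof.
pose r := rate p0 Q; have r1 : 1 <= r := rate_ge1 p0_gt0 Q0.
pose EY := expR (r * Y); have EY0 : 0 < EY by exact: expR_gt0.
pose C1 := 2 * Y ^+ 2 / p0 * EY; pose C2 := Y ^+ n * (Y ^+ 2 * EY + Y).
have C10 : 0 < C1 by rewrite !mulr_gt0// ?invr_gt0// exprn_gt0.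
have C20 : 0 < C2.
  by rewrite mulr_gt0 ?exprn_gt0// addr_gt0// mulr_gt0// exprn_gt0.
exists (C1 + C2); first exact: addr_gt0.
move=> k e F om eps eps0 hk he cF com F0 om0 hF hom y yY.
have cH : {within `[0, Y], continuous (fun y => `|F y| * expR (- (r * y)))}.
  apply: within_mul.
    exact: (@within_comp R _ F (fun z : R => `|z|) (@norm_continuous _ R)).
  apply: (@within_derive R _ (fun y => expR (- (r * y)) * (- (0 * y + r * 1)))) => z _.
  apply: is_derive_fexpR; apply: is_derive_fopp.
  exact: is_derive_fmul (is_derive_const r z) (is_derive_fid z).
have [c] := EVT_max (ltW Y0) cH; rewrite in_itv/= => cY hc.
(* [D] is the weighted sup norm of [F], attained at [c]. Evaluating [volterra_bound] at [c] lets
   [D / 2] be absorbed; [C1] and [C2] are read off from the resulting bound [DC]. *)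
pose D := `|F c| * expR (- (r * c)).
have D0 : 0 <= D by rewrite mulr_ge0// expR_ge0.
have hD z : 0 <= z <= Y -> `|F z| <= D * expR (r * z).
  move=> zY; have := hc z; rewrite in_itv/= => /(_ zY) h.
  by rewrite -ler_pdivrMr ?expR_gt0// -expRN.
have hg z : 0 < z < Y -> `|k z * F z + e z| <= z ^+ n * (Q * D * expR (r * z) + eps).
  move=> /[dup] zY /andP[z0 zY']; have zcc : 0 <= z <= Y by rewrite !ltW.
  apply: le_trans (ler_normD _ _) _; rewrite mulrDr; apply: lerD; last first.
    by rewrite mulrC; exact: he.
  rewrite normrM -[Q * D * _]mulrA mulrA [_ * Q]mulrC.
  by apply: ler_pM => //; [exact: hk|exact: hD].
have vb := volterra_bound p0_gt0 Q0 p_ge D0 eps0 cF com F0 om0 hF hom hg.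
have fb := flux_bound p0_gt0 D0 eps0 com om0 hom hg.
have DC : D <= 2 * (eps / p0 * Y ^+ 2).
  have := vb c cY; rewrite -/r => h.
  have {}h : D <= D / 2 + eps / p0 * c ^+ 2 * expR (- (r * c)).
    have E1 : expR (r * c) * expR (- (r * c)) = 1 by rewrite -expRD subrr expR0.
    apply: le_trans (ler_wpM2r (expR_ge0 (- (r * c))) h) _.
    by rewrite mulrDl -[D / 2 * _ * _]mulrA E1 mulr1.
  have : eps / p0 * c ^+ 2 * expR (- (r * c)) <= eps / p0 * Y ^+ 2.
    have ep : 0 <= eps / p0 by rewrite divr_ge0// ltW.
    have /andP[c0 cY'] := cY.
    rewrite -[X in _ <= X]mulr1; apply: ler_pM.
    - by rewrite mulr_ge0// exprn_ge0.
    - exact: expR_ge0.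
    - by apply: ler_wpM2l => //; rewrite ler_pXn2r// nnegrE// ltW.
    - rewrite -expR0 ler_expR oppr_le0 mulr_ge0//; exact: le_trans r1.
  lra.
have /andP[y0 yY'] := yY.
have Ey : expR (r * y) <= EY.
  by rewrite ler_expR ler_wpM2l//; apply: le_trans r1.
split.
  apply: le_trans (hD y yY) _.
  apply: le_trans (_ : C1 * eps <= _); last first.
    by apply: ler_wpM2r => //; rewrite lerDl ltW.
  rewrite (_ : C1 * eps = 2 * (eps / p0 * Y ^+ 2) * EY); last by rewrite /C1; ring.
  by apply: ler_pM => //; exact: expR_ge0.
apply: le_trans (fb y yY) _.
apply: le_trans (_ : C2 * eps <= _); last first.
  by apply: ler_wpM2r => //; rewrite lerDr ltW.
rewrite /C2 -[X in _ <= X]mulrA; apply: ler_pM.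
- exact: exprn_ge0.
- by rewrite addr_ge0 ?mulr_ge0 ?expR_ge0 ?invr_ge0// ltW.
- by apply: lerXn2r => //; rewrite nnegrE// ltW.
rewrite [X in _ <= X]mulrDl; apply: lerD; last by rewrite mulrC; apply: ler_wpM2r.
rewrite (_ : Y ^+ 2 * EY * eps = (2 * (eps / p0 * Y ^+ 2)) * p0 / 2 * EY); last first.
  by field; exact: lt0r_neq0.
apply: ler_pM => //.
  by rewrite !mulr_ge0// ?invr_ge0 ?ltW.
by rewrite !ler_pM2r.
Qed.

End Stability.

(** * A zero of the boundary form by varying the spectral parameter *)

Section Shooting.
Variables (R : realType) (n : nat) (Y Rad dd p0 A B mu1 : R) (p a b : R -> R).
Implicit Types (chi om : R -> R) (y z w mu nu : R).
Hypotheses (Rad0 : 0 < Rad) (RadY : Rad < Y) (dd0 : 0 < dd).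
Hypotheses (p0_gt0 : 0 < p0) (A0 : 0 <= A) (B0 : 0 <= B) (mu1_gt0 : 0 < mu1).
Hypothesis p_cts : {within `[0, Y], continuous p}.
Hypothesis a_cts : {within `[0, Y], continuous a}.
Hypothesis b_cts : {within `[0, Y], continuous b}.
Hypothesis p_ge : forall y, 0 <= y <= Y -> p0 <= p y.
Hypothesis a_le : forall y, 0 <= y <= Y -> `|a y| <= A * y ^+ n.
Hypothesis b_le : forall y, 0 <= y <= Y -> `|b y| <= B * y ^+ n.
Hypothesis a_gt0 : forall y, 0 < y < Y -> 0 < a y.
Hypothesis k_ge0 : forall y, 0 <= y <= Y -> 0 <= mu1 * a y + b y.

Let Y0 : 0 < Y := lt_trans Rad0 RadY.
Let Q := mu1 * A + B.
Let Q0 : 0 <= Q.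
Proof. by rewrite addr_ge0// mulr_ge0// ltW. Qed.

Definition spectral_sol mu chi om :=
  radial_sol n Y p (fun y => mu * a y + b y) 1 chi om.

Definition boundary_form chi om : R :=
  dd * chi Rad + Rad * (om Rad / (p Rad * Rad ^+ n)).

Definition positive_sol mu := exists chi om, [/\ spectral_sol mu chi om,
  forall y, 0 <= y <= Rad -> 0 < chi y & 0 < boundary_form chi om].

Let k_cts mu : {within `[0, Y], continuous (fun y => mu * a y + b y)}.
Proof. by apply: within_add => //; apply: within_mul => //; exact: within_cst. Qed.

Let k_le mu : 0 <= mu <= mu1 ->
  forall y, 0 <= y <= Y -> `|mu * a y + b y| <= Q * y ^+ n.
Proof.
move=> /andP[m0 m1] y yY; apply: le_trans (ler_normD _ _) _.
rewrite mulrDl; apply: lerD; last exact: b_le.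
by rewrite normrM -mulrA; apply: ler_pM => //; [rewrite ger0_norm|exact: a_le].
Qed.

Lemma spectral_sol_exists mu : 0 <= mu <= mu1 -> exists chi om, spectral_sol mu chi om.
Proof.
move=> m; have [chi [om [h _]]] :=
  radial_sol_exists Y0 p0_gt0 Q0 p_cts p_ge (@k_cts mu) (k_le m).
by exists chi, om.
Qed.

(** The difference of two solutions solves the equation at [mu] with defect [(mu - nu) * a * chi],
    where [chi] is bounded. *)
Lemma spectral_sol_continuous nu chi om (e : R) : 0 <= nu <= mu1 -> 0 < e ->
  spectral_sol nu chi om -> exists2 dl : R, 0 < dl & forall mu chi' om',
    0 <= mu <= mu1 -> `|mu - nu| < dl -> spectral_sol mu chi' om' ->
    forall y, 0 <= y <= Y -> `|chi' y - chi y| <= e /\ `|om' y - om y| <= e.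
Proof.
move=> nu01 e0 [[cchi com] [chi0 om0] hchi hom].
have [C C0 hC] := radial_stability n Y0 p0_gt0 Q0 p_ge.
have [X X_ge0 hX] := within_bounded (ltW Y0) cchi.
have X0 : 0 < X + 1 by rewrite ltr_wpDl.
have K0 : 0 < C * (A + 1) * (X + 1).
  by rewrite !mulr_gt0// ltr_wpDl.
exists (e / (C * (A + 1) * (X + 1))); first exact: divr_gt0.
move=> mu chi' om' mu01 mn [[cchi' com'] [chi'0 om'0] hchi' hom'] y yY.
pose eps := `|mu - nu| * (A + 1) * (X + 1).
have eps0 : 0 <= eps.
  by rewrite !mulr_ge0// ?ltW// ltr_wpDl.
have ep : C * eps <= e.
  move: mn; rewrite ltr_pdivlMr// => /ltW; apply: le_trans.
  by rewrite le_eqVlt; apply/orP; left; apply/eqP; rewrite /eps; ring.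
suff [h1 h2] : `|chi' y - chi y| <= C * eps /\ `|om' y - om y| <= C * eps.
  by split; [exact: le_trans ep|exact: le_trans ep].
apply: (hC (fun y => mu * a y + b y) (fun y => (mu - nu) * a y * chi y)
   (fun y => chi' y - chi y) (fun y => om' y - om y) eps eps0 (k_le mu01)) => //.
- move=> z /andP[z0 zY]; have zcc : 0 <= z <= Y by rewrite !ltW.
  rewrite !normrM /eps.
  rewrite (_ : _ * z ^+ n = `|mu - nu| * ((A + 1) * z ^+ n) * (X + 1)); last by ring.
  apply: ler_pM => //.
    apply: ler_wpM2l => //; apply: le_trans (a_le zcc) _.
    by apply: ler_wpM2r; [exact/exprn_ge0/ltW|rewrite lerDl].
  by apply: le_trans (hX z zcc) _; rewrite lerDl.
- exact: within_sub.
- exact: within_sub.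
- by rewrite chi0 chi'0 subrr.
- by rewrite om0 om'0 subrr.
- move=> z zY; rewrite mulrBl; apply: is_derive_fadd; first exact: hchi'.
  by apply: is_derive_fopp; exact: hchi.
- move=> z zY.
  have H := is_derive_fadd (hom' z zY) (is_derive_fopp (hom z zY)).
  by apply: is_derive_eq; ring.
Qed.

Lemma boundary_form_continuous (e : R) : 0 < e -> exists2 e' : R, 0 < e' &
  forall chi om chi' om', `|chi' Rad - chi Rad| <= e' -> `|om' Rad - om Rad| <= e' ->
    `|boundary_form chi' om' - boundary_form chi om| <= e.
Proof.
move=> e0; have pR : 0 < p Rad.
  by apply: lt_le_trans (p_ge _) => //; rewrite !ltW.
pose w := Rad / (p Rad * Rad ^+ n).
have w0 : 0 < w by rewrite divr_gt0// mulr_gt0// exprn_gt0.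
exists (e / (dd + w)); first by rewrite divr_gt0// addr_gt0.
move=> chi om chi' om' h1 h2.
rewrite (_ : _ - _ = dd * (chi' Rad - chi Rad) + w * (om' Rad - om Rad)); last first.
  by rewrite /boundary_form /w; field; rewrite !lt0r_neq0// ?exprn_gt0.
clearbody w; apply: le_trans (ler_normD _ _) _; rewrite !normrM (gtr0_norm dd0) (gtr0_norm w0).
rewrite [X in _ <= X](_ : e = dd * (e / (dd + w)) + w * (e / (dd + w))); last first.
  by field; rewrite lt0r_neq0// addr_gt0.
by apply: lerD; apply: ler_wpM2l => //; exact: ltW.
Qed.

Let RadYcc : 0 <= Rad <= Y.
Proof. by rewrite !ltW. Qed.

Let RY y : 0 <= y <= Rad -> 0 <= y <= Y.
Proof. by move=> /andP[-> h]; apply: le_trans h (ltW RadY). Qed.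

Lemma positive_sol_open nu : 0 <= nu <= mu1 -> positive_sol nu -> exists2 dl : R, 0 < dl &
  forall mu, 0 <= mu <= mu1 -> `|mu - nu| < dl -> positive_sol mu.
Proof.
move=> nu01 [chi [om [hs chi0 bf0]]].
have cchi : {within `[0, Rad], continuous chi}.
  by case: hs => [[cc _] _ _ _]; exact: within_le (ltW RadY) cc.
have [c cR hc] := EVT_min (ltW Rad0) cchi.
have cc0 : 0 < chi c by apply: chi0; move: cR; rewrite in_itv.
have [e' e'0 he'] := boundary_form_continuous (divr_gt0 bf0 (ltr0n _ 2)).
pose e := Num.min e' (chi c / 2).
have e0 : 0 < e by rewrite lt_min e'0 divr_gt0.
have [dl dl0 hdl] := spectral_sol_continuous nu01 e0 hs.
exists dl => // mu mu01 mn.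
have [chi' [om' hs']] := spectral_sol_exists mu01.
have h := hdl _ _ _ mu01 mn hs'.
exists chi', om'; split => // [y yR|].
  have [h1 _] := h y (RY yR).
  have : `|chi' y - chi y| <= chi c / 2 by apply: le_trans h1 _; rewrite ge_min lexx orbT.
  rewrite ler_norml => /andP[h2 _].
  have := hc y; rewrite in_itv/= => /(_ yR) h3; lra.
have [h1 h2] := h Rad RadYcc.
have : `|boundary_form chi' om' - boundary_form chi om| <= boundary_form chi om / 2.
  by apply: he'; [apply: le_trans h1 _|apply: le_trans h2 _]; rewrite ge_min lexx.
rewrite ler_norml => /andP[h3 _]; lra.
Qed.

(** With a nonnegative coefficient the regular solution stays at least 1 and its flux grows from
    0. *)
Lemma positive_sol_top : positive_sol mu1.
Proof.
have m : 0 <= mu1 <= mu1 by rewrite lexx ltW.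
have [chi [om [h hk]]] := radial_sol_exists Y0 p0_gt0 Q0 p_cts p_ge (@k_cts mu1) (k_le m).
have chi1 := hk k_ge0; exists chi, om; split => //.
  by move=> y /RY /chi1; apply: lt_le_trans.
have [[_ com] [_ om0] _ hom] := h.
have om_ge0 : 0 <= om Rad.
  rewrite -om0; apply: (@le_of_derive R om (fun y => (mu1 * a y + b y) * chi y)).
  - exact: ltW.
  - exact: within_le (ltW RadY) com.
  - by move=> y /andP[y0 yR]; apply: hom; rewrite y0 (lt_trans yR).
  - move=> y /andP[y0 yR].
    have yY : 0 <= y <= Y by rewrite !ltW// (lt_trans yR).
    by apply: mulr_ge0; [exact: k_ge0|apply: le_trans (chi1 y yY)].
rewrite /boundary_form ltr_pwDl//.
  by rewrite mulr_gt0//; apply: lt_le_trans (chi1 Rad RadYcc).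
apply: mulr_ge0; first exact: ltW.
apply: divr_ge0 => //; apply: mulr_ge0; last exact/exprn_ge0/ltW.
by apply: le_trans (p_ge RadYcc); exact: ltW.
Qed.

(* The Wronskian of [chi] with a positive solution at a larger spectral
   parameter increases from 0, so [chi] can only vanish while decreasing. *)
Lemma wronskian_neg_flux mu chi om y : mu < mu1 -> spectral_sol mu chi om ->
  0 < y <= Rad -> (forall z, 0 <= z <= y -> 0 <= chi z) -> chi y = 0 -> om y < 0.
Proof.
move=> m [[cchi com] [chi0 om0] hchi hom] /andP[y0 yR] chi_ge0 chiy.
(* The primes mark the positive solution at [mu1]; they are not derivatives. *)
have [chi' [om' [[[cchi' com'] [chi'0 om'0] hchi' hom'] chi'_gt0 _]]] := positive_sol_top.
have yY : y < Y by apply: le_lt_trans RadY.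
pose W z := om' z * chi z - om z * chi' z.
have cW : {within `[0, Y], continuous W} by apply: within_sub; exact: within_mul.
have hW z : 0 < z < Y -> is_derive z 1 W ((mu1 - mu) * a z * chi z * chi' z).
  move=> zY; have h1 := is_derive_fmul (hom' z zY) (hchi z zY).
  have h2 := is_derive_fmul (hom z zY) (hchi' z zY).
  by have h3 := is_derive_fadd h1 (is_derive_fopp h2); apply: is_derive_eq; ring.
have W0 : W 0 = 0 by rewrite /W om0 om'0 !mul0r subrr.
(* [chi] is known to be positive only near the centre, where it starts from 1; there [W] grows
   strictly, and afterwards it does not decrease. *)
have [s /andP[s0 sy] hs] : exists2 s, 0 < s < y & forall z, 0 < z < s -> 0 < chi z.
  have c1 : [set z | 0 < z] (chi 0) by rewrite /= chi0.
  have [s /andP[s0 _] hs] := within_near0 Y0 cchi (@open_gt R 0) c1.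
  exists (Num.min s (y / 2)).
    rewrite lt_min s0 divr_gt0//= gt_min; apply/orP; right; lra.
  by move=> z /andP[z0]; rewrite lt_min => /andP[zs _]; apply: hs; rewrite z0.
have chi'p z : 0 < z < y -> 0 < chi' z.
  by move=> /andP[z0 zy]; apply: chi'_gt0; rewrite !ltW// (lt_le_trans zy).
have Ws : 0 < W s.
  rewrite -W0; apply: (lt_of_derive (df := fun z => (mu1 - mu) * a z * chi z * chi' z)) => //.
  - by apply: within_le cW; apply/ltW/(lt_trans sy).
  - by move=> z /andP[z0 zs]; apply: hW; rewrite z0 (lt_trans zs)// (lt_trans sy).
  - move=> z /andP[z0 zs]; have zy : z < y by exact: lt_trans sy.
    rewrite !mulr_gt0// ?subr_gt0// ?a_gt0 ?z0 ?(lt_trans zy)//.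
      by apply: hs; rewrite z0.
    by apply: chi'p; rewrite z0.
have : W s <= W y.
  apply: (le_of_derive (df := fun z => (mu1 - mu) * a z * chi z * chi' z) (ltW sy)).
  - apply: continuous_subspaceW cW => z /=; rewrite !in_itv/= => /andP[sz zy].
    by rewrite (le_trans (ltW s0) sz) (le_trans zy)// ltW.
  - by move=> z /andP[sz zy]; apply: hW; rewrite (lt_trans s0 sz) (lt_trans zy).
  - move=> z /andP[sz zy]; have z0 : 0 < z by exact: lt_trans sz.
    rewrite !mulr_ge0//.
    + by rewrite subr_ge0 ltW.
    + by rewrite ltW// a_gt0// z0 (lt_trans zy).
    + by apply: chi_ge0; rewrite !ltW.
    + by rewrite ltW// chi'p// z0.
move=> /(lt_le_trans Ws); rewrite /W chiy mulr0 sub0r oppr_gt0.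
by rewrite pmulr_llt0// chi'_gt0// yR ltW.
Qed.

Lemma shooting chi0 om0 : spectral_sol 0 chi0 om0 ->
  (exists2 y, 0 < y <= Rad & chi0 y < 0) \/ boundary_form chi0 om0 < 0 ->
  exists mu chi om, [/\ 0 < mu, spectral_sol mu chi om & boundary_form chi om = 0].
Proof.
move=> hs0 cert.
have m0 : 0 <= (0 : R) <= mu1 by apply/andP; split => //; exact: ltW.
(* Either failure at [mu = 0] is strict, hence persists for small [mu]; this makes the supremum
   below positive. *)
have [dl0 dl0_gt0 bad0] : exists2 dl : R, 0 < dl &
    forall mu, 0 <= mu <= mu1 -> mu < dl -> ~ positive_sol mu.
  case: cert => [[y yR chiy]|bfn].
    have e0 : 0 < - chi0 y / 2 by rewrite divr_gt0// oppr_gt0.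
    have [dl dl0 h] := spectral_sol_continuous m0 e0 hs0; exists dl => // mu mu01 mdl.
    move=> [chi [om [hs chip _]]].
    have yR' : 0 <= y <= Rad by case/andP: yR => /ltW -> ->.
    have := h mu chi om mu01; rewrite subr0 ger0_norm ?(andP mu01).1//.
    move=> /(_ mdl hs y (RY yR'))[+ _]; rewrite ler_norml => /andP[_ h1].
    have := chip y yR'; lra.
  have e0 : 0 < - boundary_form chi0 om0 / 2 by rewrite divr_gt0// oppr_gt0.
  have [e' e'0 he'] := boundary_form_continuous e0.
  have [dl dl0 h] := spectral_sol_continuous m0 e'0 hs0; exists dl => // mu mu01 mdl.
  move=> [chi [om [hs _ bp]]].
  have := h mu chi om mu01; rewrite subr0 ger0_norm ?(andP mu01).1//.
  move=> /(_ mdl hs Rad RadYcc)[h1 h2].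
  by have := he' _ _ _ _ h1 h2; rewrite ler_norml => /andP[_ h3]; lra.
pose S := [set mu | 0 <= mu <= mu1 /\ ~ positive_sol mu].
have hS : has_sup S.
  split; last by exists mu1 => mu [/andP[_ ?] _].
  by exists 0; split => //; exact: bad0.
pose ms := sup S.
have ms_ub mu : S mu -> mu <= ms by move=> Smu; apply: sup_upper_bound.
have ms_le : ms <= mu1 by apply: ge_sup; [case: hS|move=> mu [/andP[_ ?] _]].
have ms0 : 0 < ms.
  pose m := Num.min (dl0 / 2) mu1.
  have mp : 0 < m by rewrite lt_min mu1_gt0 divr_gt0.
  have mm : m <= mu1 by rewrite /m ge_min lexx orbT.
  have md : m < dl0.
    have : m <= dl0 / 2 by rewrite /m ge_min lexx.
    lra.
  have m01 : 0 <= m <= mu1 by rewrite mm ltW.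
  by apply: lt_le_trans mp _; apply: ms_ub; split; [exact: m01|exact: bad0].
have ms01 : 0 <= ms <= mu1 by rewrite ms_le ltW.
(* [positive_sol] is an open condition, so failure passes to the supremum. *)
have ms_bad : ~ positive_sol ms.
  move=> /(positive_sol_open ms01)[dl dl0' h].
  have [mu Smu hmu] := sup_adherent dl0' hS.
  have mu_le := ms_ub mu Smu; case: Smu => mu01 bad; apply: bad; apply: h => //.
  rewrite ler0_norm ?subr_le0// opprB; move: hmu; rewrite -/ms => hmu; lra.
have ms_lt : ms < mu1.
  by rewrite lt_neqAle ms_le andbT; apply/eqP => e; apply: ms_bad; rewrite e; exact: positive_sol_top.
have above mu : ms < mu -> mu <= mu1 -> positive_sol mu.
  move=> mm mu_le; apply: contrapT => bad.
  have : mu <= ms by apply: ms_ub; split => //; rewrite mu_le (le_trans _ (ltW mm))// ltW.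
  by rewrite leNgt mm.
have [chi [om hs]] := spectral_sol_exists ms01.
(* All values in [(ms, mu1]] have positive solutions; letting them tend to [ms] leaves the weak
   inequalities for [chi] and its boundary form. *)
have near_pos (e : R) : 0 < e -> exists chi' om', [/\ forall y, 0 <= y <= Rad -> 0 < chi' y,
    0 < boundary_form chi' om' &
    forall y, 0 <= y <= Y -> `|chi' y - chi y| <= e /\ `|om' y - om y| <= e].
  move=> e0; have [dl dl0' h] := spectral_sol_continuous ms01 e0 hs.
  pose m := Num.min (ms + dl / 2) mu1.
  have mm : ms < m by rewrite lt_min ms_lt andbT ltrDl divr_gt0.
  have m_le : m <= mu1 by rewrite /m ge_min lexx orbT.
  have m01 : 0 <= m <= mu1 by rewrite m_le (le_trans _ (ltW mm))// ltW.
  have [chi' [om' [hs' c' b']]] := above m mm m_le.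
  exists chi', om'; split => //; apply: (h m) => //.
  rewrite gtr0_norm ?subr_gt0//.
  have : m <= ms + dl / 2 by rewrite /m ge_min lexx.
  lra.
have chi_ge0 y : 0 <= y <= Rad -> 0 <= chi y.
  move=> yR; rewrite leNgt; apply/negP => cy.
  have e0 : 0 < - chi y / 2 by rewrite divr_gt0// oppr_gt0.
  have [chi' [om' [c' _ h]]] := near_pos _ e0.
  have [+ _] := h y (RY yR); rewrite ler_norml => /andP[_ h1].
  have := c' y yR; lra.
have bf_ge0 : 0 <= boundary_form chi om.
  rewrite leNgt; apply/negP => bn.
  have e0 : 0 < - boundary_form chi om / 2 by rewrite divr_gt0// oppr_gt0.
  have [e' e'0 he'] := boundary_form_continuous e0.
  have [chi' [om' [_ b' h]]] := near_pos _ e'0.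
  have [h1 h2] := h Rad RadYcc.
  by have := he' _ _ _ _ h1 h2; rewrite ler_norml => /andP[_ h3]; lra.
have [[cchi com] [chi_0 om_0] hchi hom] := hs.
have chi_gt0 y : 0 <= y <= Rad -> 0 < chi y.
  move=> yR; rewrite lt_neqAle chi_ge0// andbT eq_sym; apply/eqP => cy.
  have /andP[y0 yR'] := yR.
  have {}y0 : 0 < y.
    rewrite lt_neqAle y0 andbT; apply/eqP => y0'.
    by move: cy; rewrite -y0' chi_0 => /eqP; rewrite oner_eq0.
  have : om y < 0.
    apply: (wronskian_neg_flux ms_lt hs) => //; first by rewrite y0.
    by move=> z /andP[z0 zy]; apply: chi_ge0; rewrite z0 (le_trans zy).
  (* A zero of [chi >= 0] has nonnegative flux: at [Rad] by the sign of the boundary form, in the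
     interior because the derivative vanishes at a minimum. *)
  apply/negP; rewrite -leNgt.
  have yY : 0 <= y <= Y := RY yR.
  have D0 : 0 < p y * y ^+ n.
    by rewrite mulr_gt0 ?exprn_gt0//; apply: lt_le_trans (p_ge yY).
  move: yR'; rewrite le_eqVlt => /predU1P[yR'|yR'].
    move: bf_ge0; rewrite /boundary_form -yR' cy mulr0 add0r.
    by rewrite pmulr_rge0// pmulr_lge0// invr_gt0.
  have dy : is_derive y 1 chi 0.
    apply: (@derive1_at_min _ chi 0 Rad y) => //; first exact: ltW.
    - move=> t; rewrite in_itv/= => /andP[t0 tR].
      by case: (hchi t _) => //; rewrite t0 (lt_trans tR).
    - by rewrite in_itv/= y0.
    - move=> t; rewrite in_itv/= => /andP[t0 tR]; rewrite cy.
      by apply: chi_ge0; rewrite !ltW.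
  have dy' : is_derive y 1 chi (om y / (p y * y ^+ n)).
    by apply: hchi; rewrite y0 (lt_trans yR').
  have : om y / (p y * y ^+ n) = 0 by have [_ <-] := dy'; have [_ ->] := dy.
  by move=> /eqP; rewrite mulf_eq0 invr_eq0 (gt_eqF D0) orbF => /eqP ->.
exists ms, chi, om; split => //.
apply/eqP; rewrite eq_le bf_ge0 andbT leNgt; apply/negP => bp.
by apply: ms_bad; exists chi, om.
Qed.

End Shooting.

(** * The Lane-Emden profile *)

Section Powers.
Variable R : realType.

(** The quotient form avoids [n.-1], so the derivatives below are rational in the quantities
    themselves and [field] can close them. *)
Lemma is_derive_pow (n : nat) (y : R) : y != 0 ->
  is_derive y 1 (fun z : R => z ^+ n) (n%:R * y ^+ n / y).
Proof.
move=> y0; have h := is_derive_fexp n (is_derive_fid y).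
apply: is_derive_eq; case: n h => [|n] h /=; first by rewrite !mul0r.
by rewrite exprSr mulr1 -mulrA mulfK.
Qed.

End Powers.

Section Profile.
Variables (R : realType) (k : nat) (gamma rho0 Rg : R) (rho : R -> R).
Implicit Types (y z Y : R).
Let d := k.+2.
Hypotheses (gamma1 : 1 <= gamma) (Rg0 : 0 < Rg).
Hypothesis prof : LE_profile_on d gamma rho0 rho Rg.

Let gamma0 : 0 < gamma := lt_le_trans ltr01 gamma1.

Definition mass : R -> R := LE_mass d rho.
(* The homology invariants [U = d ln m / d ln y] and [V = - d ln rho / d ln y]. *)
Definition hU y : R := 4 * pi * y ^+ d * rho y / mass y.
Definition hV y : R := mass y * rho y `^ (1 - gamma) / (gamma * y ^+ k).

Lemma rho_gt0 y : 0 <= y < Rg -> 0 < rho y.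
Proof. by case: prof => _ _ + _; apply. Qed.

Lemma rho_at0 : rho 0 = rho0. Proof. by case: prof. Qed.

Lemma rho_cts Y : Y < Rg -> {within `[0, Y], continuous rho}.
Proof.
move=> YR; case: prof => _ + _ _; apply: continuous_subspaceW => z /=.
by rewrite !in_itv/= => /andP[-> zY]; exact: le_lt_trans YR.
Qed.

Let integrand_cts Y : Y < Rg -> {within `[0, Y], continuous (fun y => y ^+ k.+1 * rho y)}.
Proof. by move=> YR; apply: within_mul; [apply: within_exp; exact: within_id|exact: rho_cts]. Qed.

Lemma mass0 : mass 0 = 0.
Proof.
have h : prim (fun y => y ^+ d.-1 * rho y) 0 = 0 by exact: prim0.
by rewrite /mass /LE_mass; move: h; rewrite /prim => ->; rewrite mulr0.
Qed.

Lemma mass_cts Y : 0 < Y < Rg -> {within `[0, Y], continuous mass}.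
Proof.
move=> /andP[Y0 YR]; apply: within_mul; first exact: within_cst.
by apply: (prim_cts Y0); exact: integrand_cts.
Qed.

Lemma is_derive_mass y : 0 < y < Rg ->
  is_derive y 1 mass (4 * pi * (y ^+ k.+1 * rho y)).
Proof.
move=> /andP[y0 yR]; pose Y := (y + Rg) / 2.
have yY : y < Y by rewrite /Y; lra.
have YR : Y < Rg by rewrite /Y; lra.
have h : is_derive y 1 (prim (fun y => y ^+ k.+1 * rho y)) (y ^+ k.+1 * rho y).
  by apply: (is_derive_prim (integrand_cts YR)); rewrite y0.
have h' := is_derive_fmul (is_derive_const (4 * pi) y) h.
by apply: is_derive_eq; rewrite mul0r add0r.
Qed.

Lemma mass_gt0 y : 0 < y < Rg -> 0 < mass y.
Proof.
move=> /[dup] yR /andP[y0 yR']; rewrite -mass0.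
apply: (@lt_of_derive R mass (fun z => 4 * pi * (z ^+ k.+1 * rho z)) 0 y y0).
- exact: mass_cts.
- by move=> z /andP[z0 zy]; apply: is_derive_mass; rewrite z0 (lt_trans zy).
- move=> z /andP[z0 zy].
  by rewrite !mulr_gt0// ?pi_gt0 ?exprn_gt0// rho_gt0// ltW// (lt_trans zy).
Qed.

Lemma rho_powV y : 0 <= y < Rg -> rho y `^ (1 - gamma) * rho y `^ gamma = rho y.
Proof.
by move=> /rho_gt0 r0; rewrite -powRD ?subrK ?powRr1 ?ltW// (gt_eqF r0) implybT.
Qed.

Lemma is_derive_rhog y : 0 < y < Rg ->
  is_derive y 1 (fun z => rho z `^ gamma) (- (rho y * mass y) / y ^+ k.+1).
Proof. by move=> yR; case: prof => _ _ _ /(_ y yR). Qed.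

Lemma near_interval y (P : R -> Prop) (a b : R) : a < y < b ->
  (forall z, a < z < b -> P z) -> \forall z \near y, P z.
Proof.
move=> yab h; have : \forall z \near y, z \in `]a, b[%R.
  by apply: near_in_itvoo; rewrite in_itv.
by apply: filterS => z; rewrite in_itv/=; exact: h.
Qed.

(** The profile equation differentiates only the power [gamma] of [rho]; [rho] is recovered from it
    by the power 1 / gamma. *)
Lemma is_derive_rho y : 0 < y < Rg ->
  is_derive y 1 rho (- (rho y * hV y / y)).
Proof.
move=> /[dup] yR /andP[y0 yR'].
have ycc : 0 <= y < Rg by rewrite yR' ltW.
have r0 := rho_gt0 ycc.
have rg0 : 0 < rho y `^ gamma by rewrite powR_gt0.
have h := is_derive_comp1 (g := fun z => rho z `^ gamma)
  (is_derive1_powR gamma^-1 rg0) (is_derive_rhog yR).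
have {}h : is_derive y 1 (fun z => (rho z `^ gamma) `^ gamma^-1) (- (rho y * hV y / y)).
  apply: is_derive_eq.
  rewrite -powRrM mulrBr mulfV ?gt_eqF// mulr1 /hV exprS; field.
  by rewrite !gt_eqF ?exprn_gt0.
apply: near_eq_is_derive h.
apply: (near_interval yR) => z /andP[z0 zR].
have rz : 0 <= rho z by apply/ltW/rho_gt0; rewrite zR ltW.
by rewrite -powRrM mulfV ?powRr1// gt_eqF.
Qed.

Lemma hU_gt0 y : 0 < y < Rg -> 0 < hU y.
Proof.
move=> /[dup] yR /andP[y0 yR'].
have r0 : 0 < rho y by rewrite rho_gt0// yR' ltW.
by rewrite divr_gt0 ?mass_gt0// mulr_gt0// mulr_gt0 ?exprn_gt0// mulr_gt0// pi_gt0.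
Qed.

Lemma hV_gt0 y : 0 < y < Rg -> 0 < hV y.
Proof.
move=> /[dup] yR /andP[y0 yR'].
have r0 : 0 < rho y by rewrite rho_gt0// yR' ltW.
apply: divr_gt0; apply: mulr_gt0 => //; first exact: mass_gt0.
  by rewrite powR_gt0.
by rewrite exprn_gt0.
Qed.

Lemma is_derive_massU y : 0 < y < Rg -> is_derive y 1 mass (mass y * hU y / y).
Proof.
move=> /[dup] yR /andP[y0 _]; have h := is_derive_mass yR.
apply: is_derive_eq; rewrite /hU /d !exprS; field.
by rewrite (gt_eqF y0) (gt_eqF (mass_gt0 yR)).
Qed.

Lemma is_derive_hU y : 0 < y < Rg ->
  is_derive y 1 hU (hU y * (d%:R - hV y - hU y) / y).
Proof.
move=> /[dup] yR /andP[y0 _]; have m0 := mass_gt0 yR; have y0' := lt0r_neq0 y0.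
have h1 := is_derive_fmul (is_derive_const (4 * pi) y) (is_derive_pow d y0').
have h2 := is_derive_fmul h1 (is_derive_rho yR).
have h3 := is_derive_fmul h2 (is_derive_finv (lt0r_neq0 m0) (is_derive_massU yR)).
apply: is_derive_eq; rewrite {2}/hU; move: (hV y) (hU y) (d%:R) => v u dr; field.
by rewrite (lt0r_neq0 m0) y0'.
Qed.

(** At a fixed point this bracket and the one for [hU] vanish; their sum gives (2 - gamma) V = 2,
    the origin of x. *)
Lemma is_derive_hV y : 0 < y < Rg ->
  is_derive y 1 hV (hV y * (hU y + (gamma - 1) * hV y - k%:R) / y).
Proof.
move=> /[dup] yR /andP[y0 yR']; have m0 := mass_gt0 yR; have y0' := lt0r_neq0 y0.
have r0 : 0 < rho y by rewrite rho_gt0// yR' ltW.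
have h1 := is_derive_comp1 (g := rho) (is_derive1_powR (1 - gamma) r0) (is_derive_rho yR).
have h2 := is_derive_fmul (is_derive_massU yR) h1.
have h3 := is_derive_fmul (is_derive_const gamma y) (is_derive_pow k y0').
have gy : gamma * y ^+ k != 0 by rewrite lt0r_neq0// mulr_gt0// exprn_gt0.
have h4 := is_derive_fmul h2 (is_derive_finv (f := fun z => gamma * z ^+ k) gy h3).
have E : rho y `^ (1 - gamma - 1) * rho y = rho y `^ (1 - gamma).
  by rewrite -[X in _ * X]powRr1 ?ltW// -powRD ?subrK// (gt_eqF r0) implybT.
apply: is_derive_eq; rewrite {2}/hV -E; set w := _ `^ _.
move: (hV y) (hU y) (k%:R) => v u kr; field.
by rewrite (lt0r_neq0 gamma0) y0' lt0r_neq0 ?exprn_gt0.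
Qed.

Lemma rho_decr y z : 0 <= y -> y <= z -> z < Rg -> rho z <= rho y.
Proof.
move=> y0 yz zR; rewrite -lerN2.
apply: (@le_of_derive R (fun x => - rho x) (fun x => rho x * hV x / x)) => //.
- apply: (@within_comp R _ rho (fun x => - x)).
    by move=> x; exact: opp_continuous.
  apply: continuous_subspaceW (rho_cts zR) => x /=.
  by rewrite !in_itv/= => /andP[yx ->]; rewrite (le_trans y0).
- move=> x /andP[yx xz]; have h : is_derive x 1 rho (- (rho x * hV x / x)).
    by apply: is_derive_rho; rewrite (le_lt_trans y0 yx) (lt_trans xz).
  by have h' := is_derive_fopp h; apply: is_derive_eq; rewrite opprK.
- move=> x /andP[yx xz]; have x0 : 0 < x by exact: le_lt_trans yx.
  have xR : 0 < x < Rg by rewrite x0 (lt_trans xz).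
  have r0 : 0 < rho x by rewrite rho_gt0// ltW// (lt_trans xz).
  by rewrite ltW// divr_gt0// mulr_gt0// hV_gt0.
Qed.

Lemma is_derive_ball y : is_derive y 1 (fun z : R => z ^+ d / d%:R) (y ^+ k.+1).
Proof.
have h := is_derive_fmul (is_derive_fexp d (is_derive_fid y)) (is_derive_const (d%:R)^-1 y).
apply: is_derive_eq; rewrite mulr0 addr0 mulr1 mulrAC mulfV ?mul1r//.
by rewrite pnatr_eq0.
Qed.

Lemma mass_le y : 0 <= y < Rg -> mass y <= 4 * pi * rho0 * (y ^+ d / d%:R).
Proof.
move=> /andP[]; rewrite le_eqVlt => /predU1P[<- _|y0 yR].
  by rewrite mass0 expr0n/= mul0r mulr0.
rewrite -subr_ge0.
pose f z := 4 * pi * rho0 * (z ^+ d / d%:R) - mass z.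
have -> : 0 = f 0 by rewrite /f mass0 expr0n/= mul0r mulr0 subrr.
have hc z := is_derive_fmul (is_derive_const (4 * pi * rho0) z) (is_derive_ball z).
apply: (@le_of_derive R f (fun z => (0 * (z ^+ d / d%:R) + 4 * pi * rho0 * z ^+ k.+1) -
    4 * pi * (z ^+ k.+1 * rho z))).
- exact: ltW.
- apply: within_sub; last by apply: mass_cts; rewrite y0.
  exact: (within_derive (fun z _ => hc z)).
- move=> z /andP[z0 zy]; have zR : 0 < z < Rg by rewrite z0 (lt_trans zy).
  exact: (is_derive_fadd (hc z) (is_derive_fopp (is_derive_mass zR))).
- move=> z /andP[z0 zy].
  rewrite (_ : _ - _ = 4 * pi * z ^+ k.+1 * (rho0 - rho z)); last by ring.
  rewrite mulr_ge0//; first by rewrite !mulr_ge0 ?pi_ge0 ?exprn_ge0// ltW.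
  by rewrite subr_ge0 -rho_at0 rho_decr// ?ltW// (lt_trans zy).
Qed.

Lemma mass_ge y : 0 < y < Rg -> 4 * pi * rho y * (y ^+ d / d%:R) <= mass y.
Proof.
move=> /[dup] yRg /andP[y0 yR]; rewrite -subr_ge0.
pose f z := mass z - 4 * pi * rho y * (z ^+ d / d%:R).
have -> : 0 = f 0 by rewrite /f mass0 expr0n/= mul0r mulr0 subrr.
have hc z := is_derive_fmul (is_derive_const (4 * pi * rho y) z) (is_derive_ball z).
apply: (@le_of_derive R f (fun z => 4 * pi * (z ^+ k.+1 * rho z) -
    (0 * (z ^+ d / d%:R) + 4 * pi * rho y * z ^+ k.+1))).
- exact: ltW.
- apply: within_sub; first by apply: mass_cts; rewrite y0.
  exact: (within_derive (fun z _ => hc z)).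
- move=> z /andP[z0 zy]; have zR : 0 < z < Rg by rewrite z0 (lt_trans zy).
  exact: (is_derive_fadd (is_derive_mass zR) (is_derive_fopp (hc z))).
- move=> z /andP[z0 zy].
  rewrite (_ : _ - _ = 4 * pi * z ^+ k.+1 * (rho z - rho y)); last by ring.
  rewrite mulr_ge0//; first by rewrite !mulr_ge0 ?pi_ge0 ?exprn_ge0// ltW.
  by rewrite subr_ge0 rho_decr// ltW.
Qed.

(** [U / d] is the ratio of the local density to the mean density inside radius y, and [rho]
    decreases. *)
Lemma hU_le y : 0 < y < Rg -> hU y <= d%:R.
Proof.
move=> yR; rewrite /hU ler_pdivrMr ?mass_gt0//.
have d0 : 0 < d%:R :> R by rewrite ltr0n.
rewrite [X in _ <= X]mulrC -ler_pdivrMr//; apply: le_trans (mass_ge yR).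
by rewrite le_eqVlt; apply/orP; left; apply/eqP; ring.
Qed.

(** A quantitative form of V --> 0 at the centre: the mass is of order [y ^+ d], and the power
    [1 - gamma] of [rho], which does not decrease outwards, is frozen at [Y]. *)
Lemma hV_small Y : 0 < Y < Rg -> exists2 C : R, 0 <= C &
  forall y, 0 < y <= Y -> hV y <= C * y ^+ 2.
Proof.
move=> /andP[Y0 YR].
have rho00 : 0 < rho0 by rewrite -rho_at0 rho_gt0// lexx.
exists (4 * pi * rho0 / d%:R * rho Y `^ (1 - gamma) / gamma).
  by rewrite !mulr_ge0// ?pi_ge0 ?invr_ge0 ?powR_ge0 ?ltW.
move=> y /andP[y0 yY]; have yR : y < Rg by exact: le_lt_trans YR.
have ycc : 0 <= y < Rg by rewrite yR ltW.
have r0 := rho_gt0 ycc.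
rewrite /hV ler_pdivrMr; last by rewrite mulr_gt0// exprn_gt0.
rewrite (_ : _ * (gamma * _) = 4 * pi * rho0 * (y ^+ d / d%:R) * rho Y `^ (1 - gamma)); last first.
  have d0 : d%:R != 0 :> R by rewrite pnatr_eq0.
  rewrite /d [y ^+ k.+2]exprS [y ^+ k.+1]exprS; move: d0; set dr : R := _%:R => d0.
  by field; rewrite (gt_eqF gamma0) d0.
apply: ler_pM.
- by rewrite ltW// mass_gt0// y0.
- exact: powR_ge0.
- exact: mass_le.
- have rY : 0 < rho Y by rewrite rho_gt0// ltW.
  rewrite -[1 - gamma]opprB !powRN lef_pV2 ?posrE ?powR_gt0//.
  have rYy : rho Y <= rho y by apply: rho_decr => //; exact: ltW.
  by apply: ge0_ler_powR => //; rewrite ?nnegrE ?subr_ge0 // ltW.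
Qed.

End Profile.

(** * A bound on the central density *)

Section Algebra.
Variable R : realType.

(* This is where the dimension enters: for [x < (D + 2) / 2] the linearisation at
   the singular solution is a focus exactly when [4 x (D - x) > (D - 2)^2]; for
   larger [x] its real eigendirections have slope below -1. *)
Lemma slope_form_pos (D x : R) : 3 <= D -> D < 10 -> 2 <= x -> x < D ->
  exists2 dl : R, 0 < dl &
  forall w : R, 0 <= 1 + w -> dl <= (D - x) * w ^+ 2 + (D - 2) * w + x.
Proof.
move=> D3 D10 x2 xD; have [h|h] := leP ((D + 2) / 2) x.
  (* In powers of 1 + w the form is 2 + (2x - D - 2)(1 + w) + (D - x)(1 + w)^2, so its minimum on
     the half-line is 2. *)
  exists 2 => // w w1.
  have h1 : 0 <= 2 * x - D - 2 by lra.
  have h2 : 0 <= w + 1 by lra.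
  have h3 : 0 <= D - x by lra.
  rewrite -subr_ge0.
  rewrite (_ : _ - 2 = (2 * x - D - 2) * (w + 1) + (D - x) * (w + 1) ^+ 2); last by ring.
  by apply: addr_ge0; apply: mulr_ge0; rewrite ?sqr_ge0.
have Dx : 0 < D - x by lra.
exists ((4 * x * (D - x) - (D - 2) ^+ 2) / (4 * (D - x))).
  apply: divr_gt0; last by lra.
  (* The numerator is concave in [x], with the value (D - 2)(10 - D) at [x = 2], the isothermal
     case, and 4 (D - 2) at [x = (D + 2) / 2]. So [D < 10] is what the isothermal end requires. *)
  rewrite (_ : _ - _ = 4 * ((x - 2) * ((D + 2) / 2 - x)) + 2 * (((D + 2) / 2 - x) * (10 - D))
     + 8 * (x - 2)); last by field.
  have h1 : 0 <= (x - 2) * ((D + 2) / 2 - x) by rewrite mulr_ge0//; lra.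
  have h2 : 0 < ((D + 2) / 2 - x) * (10 - D) by rewrite mulr_gt0//; lra.
  lra.
move=> w _; rewrite ler_pdivrMr; last by lra.
rewrite -subr_ge0 (_ : _ - _ = (2 * (D - x) * w + (D - 2)) ^+ 2); last by ring.
exact: sqr_ge0.
Qed.

(** For [w = b / a] the expression is the derivative of [w - K a + c ln rho] in ln y: the terms
    without [K] and [c] come from [w], and [(D - x + a) * a * (1 + w)] is the rate at which [a]
    decreases. Near the fixed point the quadratic form is positive by itself; away from it the term
    with [K] takes over. *)
Lemma lyapunov_form_pos (D x gamma kap : R) : 3 <= D -> D < 10 -> 2 <= x -> x < D ->
  gamma * x = 2 * x - 2 -> 1 <= gamma < 2 ->
  exists K c : R, [/\ 0 < K, 0 < c & forall a w : R, 0 < a <= x -> 0 <= 1 + w <= 1 + kap ->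
  0 <= (D - x) * w ^+ 2 + (D - 2) * w + x + a * w * (2 + gamma * w)
       + K * (D - x + a) * a * (1 + w) - c * (x + a * w)].
Proof.
move=> D3 D10 x2 xD gx /andP[g1 g2]; have [dl dl0 hq] := slope_form_pos D3 D10 x2 xD.
have Dx : 0 < D - x by lra.
have x0 : 0 < x by lra.
pose c := Num.min (Num.min 1 (2 - gamma)) (dl / (2 * x)).
have c0 : 0 < c.
  rewrite !lt_min ltr01 subr_gt0 g2/=; apply: divr_gt0 => //; lra.
have c1 : c <= 1 by rewrite /c !ge_min lexx.
have cg : c <= 2 - gamma by rewrite /c !ge_min lexx orbT.
have cd : c * x <= dl / 2.
  have : c <= dl / (2 * x) by rewrite /c ge_min lexx orbT.
  rewrite ler_pdivlMr; last lra.
  by move=> h; lra.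
clearbody c.
pose K := 4 * (3 * x + D) / (dl * (D - x)).
have K0 : 0 < K by apply: divr_gt0; [lra|exact: mulr_gt0].
have KE : K * (dl / 4) * (D - x) = 3 * x + D.
  by rewrite /K; field; rewrite !lt0r_neq0.
clearbody K.
exists K, c; split => // a w /andP[a0 ax] /andP[w1 wk].
(* For small [a] the form supplies [dl]; [c * x] and the loss [2 * a] each take at most half of
   it. *)
have [ha|ha] := leP a (dl / 4).
  have h1 := hq w w1.
  have h2 : 0 <= w * (2 + gamma * w) - c * w + 2.
    have [w0|w0] := leP 0 w.
      have : 0 <= w * (2 - c + gamma * w).
        by rewrite mulr_ge0// addr_ge0 ?mulr_ge0//; lra.
      lra.
    have h3 : 0 <= gamma * w ^+ 2 by rewrite mulr_ge0 ?sqr_ge0//; lra.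
    have h4 : 0 <= (- w) * c by rewrite mulr_ge0//; lra.
    lra.
  have h3 : 0 <= K * (D - x + a) * a * (1 + w) by rewrite !mulr_ge0//; lra.
  have h4 : 0 <= a * (w * (2 + gamma * w) - c * w + 2) by rewrite mulr_ge0//; lra.
  lra.
(* For larger [a] everything is expanded in powers of [1 + w] with nonnegative coefficients; the
   choice of [K] takes care of the linear one. *)
have h1 : 0 <= (2 - gamma - c) * (x - a) by rewrite mulr_ge0//; lra.
have h2 : 3 * x + D <= K * a * (D - x).
  by rewrite -KE; apply: ler_wpM2r; [lra|apply: ler_wpM2l; lra].
have h3 : 0 <= K * a * a by rewrite !mulr_ge0//; lra.
have h4 : 0 <= a * (2 - 2 * gamma - c) + 3 * x.
  have : 0 <= a * (2 * gamma - 2 + c) by rewrite mulr_ge0//; lra.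
  have : 0 <= a * (3 - (2 * gamma - 2 + c)) by rewrite mulr_ge0//; lra.
  lra.
have h5 : 0 <= (1 + w) * (2 * x - D - 2 + a * (2 - 2 * gamma - c) + K * a * (D - x) + K * a * a).
  by rewrite mulr_ge0//; lra.
have h6 : 0 <= (1 + w) ^+ 2 * (D - x + gamma * a).
  by rewrite mulr_ge0 ?sqr_ge0// addr_ge0 ?mulr_ge0//; lra.
rewrite [X in _ <= X](_ : _ = (2 - gamma - c) * (x - a) +
  (1 + w) * (2 * x - D - 2 + a * (2 - 2 * gamma - c) + K * a * (D - x) + K * a * a) +
  (1 + w) ^+ 2 * (D - x + gamma * a) + (gamma * x - (2 * x - 2))); last by ring.
lra.
Qed.

End Algebra.

(** * Orbits without a certificate *)

Section Turning.
Variables (R : realType) (k : nat) (gamma rho0 Rg Rad x K c : R) (rho : R -> R).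
Implicit Types (y z : R).
Let d := k.+2.
Let Us : R := d%:R - x.
Let kap : R := x / Us.
Hypotheses (gamma1 : 1 <= gamma) (gamma2 : gamma < 2).
Hypotheses (x2 : 2 <= x) (xd : x < d%:R) (gx : gamma * x = 2 * x - 2).
Hypotheses (Rad0 : 0 < Rad) (RadRg : Rad < Rg).
Hypothesis prof : LE_profile_on d gamma rho0 rho Rg.
Hypotheses (K0 : 0 < K) (c0 : 0 < c).
Hypothesis lyap : forall a w : R, 0 < a <= x -> 0 <= 1 + w <= 1 + kap ->
  0 <= Us * w ^+ 2 + (d%:R - 2) * w + x + a * w * (2 + gamma * w)
       + K * (Us + a) * a * (1 + w) - c * (x + a * w).
Notation U := (hU k rho).
Notation V := (hV k gamma rho).
Notation m := (mass k rho).
Hypothesis U_ge : forall y, 0 < y <= Rad -> Us <= U y.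
Hypothesis V_le_end : Us * V Rad <= x * U Rad.
Hypothesis rho_end : rho Rad = 1.

Let dE : d%:R = k%:R + 2 :> R.
Proof. by rewrite /d -addn2 natrD. Qed.

Let Us0 : 0 < Us. Proof. by rewrite subr_gt0. Qed.
Let x0 : 0 < x := lt_le_trans (ltr0n _ 2) x2.
Let Rg0 : 0 < Rg := lt_trans Rad0 RadRg.
Let in_Rg y : 0 < y <= Rad -> 0 < y < Rg.
Proof. by move=> /andP[-> h]; exact: le_lt_trans RadRg. Qed.

Let dU y (yR : 0 < y < Rg) := is_derive_hU gamma1 prof yR.
Let dV y (yR : 0 < y < Rg) := is_derive_hV gamma1 prof yR.
Let drho y (yR : 0 < y < Rg) := is_derive_rho gamma1 prof yR.

(* [h = m rho (U + V - d)] tends to 0 at the centre, and it increases wherever it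
   is negative, because there [V < d - Us = x]. *)
Lemma UV_ge y1 : 0 < y1 <= Rad -> d%:R <= U y1 + V y1.
Proof.
move=> y1R; have /andP[y10 y1Rad] := y1R.
(* [m * rho] is an integrating factor: in the derivative every term with [U] cancels, and the sign
   left is that of 2 - (2 - gamma) V, positive for V < x. *)
pose h y := m y * rho y * (U y + V y - d%:R).
pose dh y := m y * rho y * V y * (2 - (2 - gamma) * V y) / y.
have hh y : 0 < y < Rg -> is_derive y 1 h (dh y).
  move=> yR; have y0 : y != 0 by case/andP: yR => /lt0r_neq0.
  have h1 := is_derive_fmul (is_derive_massU prof yR) (drho yR).
  have h2 := is_derive_fadd (is_derive_fadd (dU yR) (dV yR)) (is_derive_const (- d%:R) y).
  have h3 := is_derive_fmul h1 h2; apply: is_derive_eq.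
  by rewrite /dh -/d dE; move: (m y) (rho y) (U y) (V y) => M r u v; field.
rewrite leNgt; apply/negP => lt_d.
have y1g := in_Rg y1R.
have m1 := mass_gt0 prof y1g.
have r1 : 0 < rho y1 by apply: (rho_gt0 prof); case/andP: y1g => /ltW -> ->.
have hneg : h y1 < 0.
  have mr : 0 < m y1 * rho y1 by exact: mulr_gt0.
  by rewrite /h (pmulr_rlt0 _ mr) subr_lt0.
have below y : 0 < y <= y1 -> h y < h y1 / 2.
  move=> /andP[y0 yy1]; apply: (@stays_below R h dh y y1 _ yy1).
  - move=> z /andP[yz zy1]; apply: hh; rewrite (lt_le_trans y0 yz)/=.
    by apply: le_lt_trans zy1 _; case/andP: y1g.
  - move=> z /andP[yz zy1] hz; have z0 : 0 < z := lt_le_trans y0 yz.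
    have zR : 0 < z <= Rad by rewrite z0 (le_trans zy1).
    have mz := mass_gt0 prof (in_Rg zR).
    have vz := hV_gt0 gamma1 prof (in_Rg zR).
    have rz : 0 < rho z by apply: (rho_gt0 prof); case/andP: (in_Rg zR) => /ltW -> ->.
    have : h z < 0 by lra.
    have mr : 0 < m z * rho z by exact: mulr_gt0.
    rewrite /h (pmulr_rlt0 _ mr) => UVz.
    have Vx : V z < x.
      by have := U_ge zR; move: UVz; rewrite /Us; move: (U z) (V z) (d%:R) => u v D; lra.
    have h1 : 0 < (2 - gamma) * (x - V z) by rewrite mulr_gt0 ?subr_gt0.
    have h2 : (2 - gamma) * x = 2 by rewrite mulrBl gx; ring.
    by apply: divr_gt0 => //; apply: mulr_gt0; [exact: mulr_gt0 mr vz|move: h1; rewrite mulrBr h2].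
  - lra.
have rho00 : 0 < rho0 by rewrite -(rho_at0 prof) (rho_gt0 prof)// lexx.
(* Since [h >= - d * rho0 * m] and the mass tends to 0, [h] cannot stay below the negative constant
   [h y1 / 2] down to the centre. *)
have e0 : 0 < - h y1 / 2 / (d%:R * rho0).
  apply: divr_gt0; last by rewrite mulr_gt0 ?ltr0n.
  by apply: divr_gt0 => //; rewrite oppr_gt0.
have mc : {within `[0, y1], continuous m} by exact: mass_cts prof _ _.
have [s /andP[s0 sy1] hs] := within_near0 y10 mc (@open_lt R _)
  (eq_ind_r (fun z => z < _) e0 (mass0 k rho)).
pose y := s / 2; have y0 : 0 < y by rewrite divr_gt0.
have ys : y < s by rewrite /y; lra.
have yy1 : 0 < y <= y1 by rewrite y0 (le_trans (ltW ys)).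
have yR : 0 < y <= Rad by case/andP: yy1 => -> h1; rewrite (le_trans h1).
have yg := in_Rg yR; have my := mass_gt0 prof yg.
have my' : m y < - h y1 / 2 / (d%:R * rho0) by apply: hs; rewrite y0.
move: my'; rewrite ltr_pdivlMr ?mulr_gt0 ?ltr0n// => my'.
have ry : 0 < rho y <= rho0.
  case/andP: yg => _ yg'; rewrite (rho_gt0 prof) ?(ltW y0)//=.
  by rewrite -(rho_at0 prof); apply: (rho_decr gamma1 prof) => //; exact: ltW.
have := below y yy1; apply/negP; rewrite -leNgt.
have : - (m y * (d%:R * rho0)) <= h y.
  have uv : 0 <= U y + V y.
    have u0 : 0 < U y := hU_gt0 prof yg.
    have v0 : 0 < V y := hV_gt0 gamma1 prof yg.
    by rewrite ltW// addr_gt0.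
  have /andP[ry0 ry1] := ry.
  rewrite /h (_ : _ * (_ - _) = m y * rho y * (U y + V y) - m y * (d%:R * rho y)); last by ring.
  apply: ler_wpDl; last first.
    rewrite lerN2; apply: ler_wpM2l; first exact: ltW.
    by apply: ler_wpM2l.
  by apply: mulr_ge0 => //; apply: mulr_ge0; exact: ltW.
lra.
Qed.

(** Above the ray, [U >= Us] forces V > x, and then V / U increases. An excursion would last until
    [Rad], against [V_le_end]; so the surface condition is carried inwards. *)
Lemma ray_le y1 : 0 < y1 <= Rad -> Us * V y1 <= x * U y1.
Proof.
move=> y1R; rewrite leNgt; apply/negP => hlt.
have u y (yR : 0 < y <= Rad) : 0 < U y := hU_gt0 prof (in_Rg yR).
have v y (yR : 0 < y <= Rad) : 0 < V y := hV_gt0 gamma1 prof (in_Rg yR).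
have kapE y : 0 < y <= Rad -> (kap < V y / U y) = (x * U y < Us * V y).
  by move=> yR; rewrite /kap ltr_pdivrMr// mulrAC ltr_pdivlMr ?u// [V y * _]mulrC.
have RadR : 0 < Rad <= Rad by rewrite Rad0 lexx.
move: V_le_end; rewrite leNgt -kapE// => /negP; apply.
have /andP[y10 y1Rad] := y1R.
have sub y : y1 <= y <= Rad -> 0 < y <= Rad.
  by move=> /andP[h ->]; rewrite (lt_le_trans y10).
apply: (@stays_above R (fun y => V y / U y)
  (fun y => V y / U y * (2 * U y + gamma * V y - 2 * (d%:R - 1)) / y) y1 Rad _ y1Rad).
- move=> y /sub yR; have yg := in_Rg yR.
  have h := is_derive_fmul (dV yg) (is_derive_finv (lt0r_neq0 (u y yR)) (dU yg)).
  apply: is_derive_eq; rewrite -/d dE; have := u y yR; have : 0 < y by case/andP: yR.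
  move: (U y) (V y) => U' V' y0 U0; field.
  by rewrite !lt0r_neq0.
- move=> y /sub yR; rewrite kapE// => h.
  have y0 : 0 < y by case/andP: yR.
  apply: divr_gt0 => //; apply: mulr_gt0; first by apply: divr_gt0; [exact: v|exact: u].
  have Vx : x < V y.
    rewrite -(ltr_pM2l Us0); apply: le_lt_trans h; rewrite mulrC.
    by apply: ler_wpM2l; [exact: ltW|exact: U_ge].
  have := U_ge yR; have gx' := gx; have g1 := gamma1; rewrite /Us => Uy.
  have : 0 < gamma * (V y - x) by rewrite mulr_gt0 ?subr_gt0//; lra.
  lra.
- by rewrite kapE.
Qed.

(* [U = Us] at one point would force [(U, V) = (Us, x)] on all of (0, y1], against
   [V --> 0] at the centre. *)
Lemma U_gt y1 : 0 < y1 <= Rad -> Us < U y1.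
Proof.
move=> y1R; rewrite lt_neqAle U_ge// andbT; apply/eqP => Uy1.
have /andP[y10 y1Rad] := y1R.
(* Gronwall in power form: on the cone, a = U - Us satisfies y a' = - U (a + b) >= - d (1 + kap) a,
   so [f] is nondecreasing and a zero at [y1] forces zeros at all smaller radii. *)
have [N hN] : exists N : nat, d%:R * (1 + kap) <= N%:R :> R.
  exists (Num.truncn (d%:R * (1 + kap))).+1; apply/ltW; exact: truncnS_gt.
pose f y := (U y - Us) * y ^+ N.
pose df y := y ^+ N / y * (N%:R * (U y - Us) - U y * (U y + V y - d%:R)).
have hf y : 0 < y < Rg -> is_derive y 1 f (df y).
  move=> yR; have y0 : y != 0 by case/andP: yR => /lt0r_neq0.
  have h := is_derive_fmul (is_derive_fadd (dU yR) (is_derive_const (- Us) y)) (is_derive_pow N y0).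
  apply: is_derive_eq; rewrite /df -/d dE; move: (U y) (V y) => U' V'.
  by field.
have sub y : 0 < y <= y1 -> 0 < y <= Rad.
  by move=> /andP[-> h]; exact: le_trans y1Rad.
have Ueq y : 0 < y <= y1 -> U y = Us.
  move=> yy1; have yR := sub y yy1; have /andP[y0 yy1'] := yy1.
  apply/eqP; rewrite eq_le U_ge// andbT -subr_le0.
  have yN : 0 < y ^+ N by rewrite exprn_gt0.
  rewrite -(pmulr_lle0 _ yN).
  have <- : f y1 = 0 by rewrite /f -Uy1 subrr mul0r.
  apply: (@le_of_derive R f df y y1 yy1').
  - apply: (@within_derive R f df y y1) => z /andP[yz zy1]; apply: hf; apply: in_Rg; apply: sub.
    by rewrite (lt_le_trans y0).
  - move=> z /andP[yz zy1]; apply: hf; apply: in_Rg; apply: sub.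
    by rewrite (lt_trans y0)//= ltW.
  - move=> z /andP[yz zy1]; have z0 : 0 < z := lt_trans y0 yz.
    have zR : 0 < z <= Rad by apply: sub; rewrite z0 ltW.
    rewrite /df mulr_ge0//; first by rewrite divr_ge0 ?exprn_ge0 ?ltW.
    have a0 := U_ge zR; have b0 := ray_le zR; have g0 := UV_ge zR.
    have ud := hU_le gamma1 prof (in_Rg zR).
    have V_le : V z - x <= kap * (U z - Us).
      rewrite -(ler_pM2l Us0) (_ : Us * (kap * _) = x * (U z - Us)); first by lra.
      by rewrite /kap; field; exact: lt0r_neq0.
    have h1 : U z + V z - d%:R <= (1 + kap) * (U z - Us) by move: V_le; rewrite /Us; lra.
    rewrite subr_ge0; apply: le_trans (_ : d%:R * ((1 + kap) * (U z - Us)) <= _); last first.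
      by rewrite mulrA; apply: ler_wpM2r; rewrite ?subr_ge0.
    apply: ler_pM => //; last by rewrite subr_ge0.
    exact: ltW (hU_gt0 prof (in_Rg zR)).
(* With [U = Us], [UV_ge] gives V >= x down to the centre; the radius chosen next is small enough
   for C y^2 < x. *)
have [C C0 hC] := hV_small gamma1 Rg0 prof (in_Rg y1R).
pose y := Num.min (Num.min y1 1) (x / (C + 1)).
have C10 : 0 < C + 1 by rewrite ltr_wpDl.
have y0 : 0 < y by rewrite !lt_min y10 ltr01 divr_gt0.
have yy1 : 0 < y <= y1 by rewrite y0 /y !ge_min lexx.
have y_le1 : y <= 1 by rewrite /y !ge_min lexx orbT.
have yC : y <= x / (C + 1) by rewrite /y ge_min lexx orbT.
clearbody y.
have Vx : x <= V y by have := UV_ge (sub y yy1); rewrite Ueq// /Us; lra.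
have := hC y yy1; apply/negP; rewrite -ltNge; apply: lt_le_trans Vx.
move: yC; rewrite ler_pdivlMr// => yC.
have : C * y ^+ 2 <= C * y.
  apply: ler_wpM2l => //; rewrite expr2; apply: ler_piMr => //; exact: ltW.
lra.
Qed.

(* Along the orbit, [b / a - K a + c ln rho] is nondecreasing. *)
Lemma central_density_le : rho0 <= expR ((1 + kap + K * x) / c).
Proof.
pose a y := U y - Us; pose b y := V y - x.
pose F y := b y / a y - K * a y + c * ln (rho y).
pose dF y := (Us * (b y / a y) ^+ 2 + (d%:R - 2) * (b y / a y) + x
  + a y * (b y / a y) * (2 + gamma * (b y / a y))
  + K * (Us + a y) * a y * (1 + b y / a y) - c * (x + a y * (b y / a y))) / y.
have a0 y : 0 < y <= Rad -> 0 < a y by move=> yR; rewrite subr_gt0 U_gt.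
have hF y : 0 < y <= Rad -> is_derive y 1 F (dF y).
  move=> yR; have yg := in_Rg yR; have ay := lt0r_neq0 (a0 y yR).
  have y0 : y != 0 by case/andP: yR => /lt0r_neq0.
  have r0 : 0 < rho y by apply: (rho_gt0 prof); case/andP: yg => /ltW -> ->.
  have ha := is_derive_fadd (dU yg) (is_derive_const (- Us) y).
  have hb := is_derive_fadd (dV yg) (is_derive_const (- x) y).
  have h1 := is_derive_fmul hb (is_derive_finv ay ha).
  have h2 := is_derive_fopp (is_derive_fmul (is_derive_const K y) ha).
  have h3 := is_derive_fmul (is_derive_const c y)
    (is_derive_comp1 (g := rho) (is_derive1_ln r0) (drho yg)).
  have h4 := is_derive_fadd (is_derive_fadd h1 h2) h3.
  apply: is_derive_eq; rewrite /dF -/d.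
  have -> : U y = Us + a y by rewrite /a; ring.
  have -> : V y = x + b y by rewrite /b; ring.
  have dE' : d%:R = Us + x by rewrite /Us; ring.
  have r0' := lt0r_neq0 r0.
  have kE : k%:R = Us + x - 2 by rewrite -dE' dE; ring.
  have gE : gamma = 2 - 2 / x.
    by apply: (mulIf (lt0r_neq0 x0)); rewrite gx mulrBl divfK ?lt0r_neq0.
  rewrite dE' kE gE; have x0' := lt0r_neq0 x0.
  move: (a y) (b y) ay Us => A B ay us; field.
  by rewrite ay y0 r0' x0'.
have slope y : 0 < y <= Rad -> 0 <= 1 + b y / a y <= 1 + kap.
  move=> yR; have ay := a0 y yR.
  have h1 : 0 <= a y + b y.
    have := UV_ge yR; rewrite /a /b /Us; move: (U y) (V y) (d%:R) => u v D; lra.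
  apply/andP; split.
    rewrite (_ : _ + _ = (a y + b y) / a y); last by field; exact: lt0r_neq0.
    by apply: divr_ge0 => //; exact: ltW.
  rewrite lerD2l ler_pdivrMr// -(ler_pM2l Us0).
  rewrite (_ : Us * (kap * _) = x * a y); last by rewrite /kap; field; exact: lt0r_neq0.
  have := ray_le yR; rewrite /a /b; move: (U y) (V y) Us => u v us; lra.
have a_le y : 0 < y <= Rad -> a y <= x.
  move=> yR; have := hU_le gamma1 prof (in_Rg yR).
  rewrite -/d /a /Us; move: (U y) (d%:R) => u D; lra.
have RadR : 0 < Rad <= Rad by rewrite Rad0 lexx.
have FRad : F Rad <= kap.
  have /andP[_ h1] := slope _ RadR; have := a0 _ RadR => h2.
  have h3 : 0 <= K * a Rad by rewrite mulr_ge0// ltW.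
  by rewrite /F rho_end ln1 mulr0 addr0; lra.
have Fmono y : 0 < y <= Rad -> F y <= F Rad.
  move=> /andP[y0 yRad]; apply: (@le_of_derive R F dF _ _ yRad).
  - apply: (@within_derive R F dF y Rad) => z /andP[yz zR]; apply: hF.
    by rewrite (lt_le_trans y0).
  - by move=> z /andP[yz zR]; apply: hF; rewrite (lt_trans y0)//= ltW.
  - move=> z /andP[yz zR]; have z0 : 0 < z := lt_trans y0 yz.
    have zRad : 0 < z <= Rad by rewrite z0 ltW.
    apply: divr_ge0; last exact: ltW.
    by apply: lyap; [rewrite a0//= a_le|exact: slope].
have rho_pos y : 0 < y <= Rad -> 0 < rho y.
  by move=> yR; apply: (rho_gt0 prof); case/andP: (in_Rg yR) => /ltW -> ->.
(* On the cone [w] lies in [-1, kap] and [a] in (0, x], so [w - K a] increases by at most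
   [1 + kap + K * x]; with [ln (rho Rad) = 0] this bounds [c * ln (rho y)]. *)
have rho_le y : 0 < y <= Rad -> rho y <= expR ((1 + kap + K * x) / c).
  move=> yR; rewrite -[rho y](lnK (rho_pos y yR)) ler_expR ler_pdivlMr// mulrC.
  have := le_trans (Fmono y yR) FRad; have /andP[h1 _] := slope y yR.
  have h2 : K * a y <= K * x by apply: ler_wpM2l; [exact: ltW|exact: a_le].
  rewrite /F => h3; lra.
(* [hU] has a junk value at 0, so the bound reaches [rho0] through continuity of [rho]. *)
rewrite leNgt; apply/negP => hlt.
have rc := rho_cts prof RadRg.
have hr0 : [set z | expR ((1 + kap + K * x) / c) < z] (rho 0) by rewrite /= (rho_at0 prof).
have [s /andP[s0 sR] hs] := within_near0 Rad0 rc (@open_gt R _) hr0.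
have s2 : 0 < s / 2 < s by apply/andP; split; lra.
have := hs _ s2; rewrite /= ltNge rho_le//.
by case/andP: s2 => -> /ltW h; rewrite (le_trans h).
Qed.

End Turning.

(** * Liquid stars *)

Section Star.
Variables (R : realType) (k : nat) (gamma rho0 Rg Rad Y x : R) (rho : R -> R).
Implicit Types (y z mu : R) (chi om : R -> R).
Let d := k.+2.
Let n := k.+3.
Let Us : R := d%:R - x.
Hypotheses (gamma1 : 1 <= gamma) (gamma2 : gamma < 2).
Hypotheses (x0 : 0 < x) (xd : x < d%:R) (gx : gamma * x = 2 * x - 2).
Hypotheses (Rad0 : 0 < Rad) (RadY : Rad < Y) (YRg : Y < Rg).
Hypothesis prof : LE_profile_on d gamma rho0 rho Rg.
Notation U := (hU k rho).
Notation V := (hV k gamma rho).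
Notation m := (mass k rho).

Let gamma0 : 0 < gamma := lt_le_trans ltr01 gamma1.
Let Y0 : 0 < Y := lt_trans Rad0 RadY.
Let Rg0 : 0 < Rg := lt_trans Y0 YRg.
Let Us0 : 0 < Us. Proof. by rewrite subr_gt0. Qed.
Let dE : d%:R = k%:R + 2 :> R.
Proof. by rewrite /d -addn2 natrD. Qed.
Let Ycc : 0 < Y < Rg. Proof. by rewrite Y0. Qed.
Let in_Rg y : 0 < y <= Y -> 0 < y < Rg.
Proof. by move=> /andP[-> h]; exact: le_lt_trans YRg. Qed.
Let in_Rg_oo y : 0 < y < Y -> 0 < y < Rg.
Proof. by move=> /andP[-> h]; exact: lt_trans YRg. Qed.
Let in_Rg0 y : 0 <= y <= Y -> 0 <= y < Rg.
Proof. by move=> /andP[-> h]; exact: le_lt_trans YRg. Qed.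
Let rho_pos y : 0 <= y <= Y -> 0 < rho y.
Proof. by move=> /in_Rg0; exact: (rho_gt0 prof). Qed.

Definition pressure y : R := gamma * rho y `^ gamma.
Definition cpl : R := 2 * (d%:R - 1) - d%:R * gamma.
Definition weight y : R := y ^+ n * rho y.
(** The coefficient cpl y^d (rho^gamma)' of [LE_L], rewritten by the hydrostatic equation so that it
    is regular at the centre. *)
Definition potential y : R := - (cpl * (y * rho y * m y)).

(** From (2 - gamma) x = 2. Hence gamma < 2 (d - 1) / d says exactly that [Us] is positive. *)
Let cplE : cpl = (2 - gamma) * Us.
Proof. by rewrite /cpl /Us [(2 - gamma) * (_ - _)]mulrBr [(2 - gamma) * x]mulrBl gx; ring. Qed.
Let cpl0 : 0 < cpl.
Proof. by rewrite cplE mulr_gt0 ?subr_gt0. Qed.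

Let rhoc : {within `[0, Y], continuous rho}. Proof. exact: rho_cts prof _ YRg. Qed.
Let massc : {within `[0, Y], continuous m}. Proof. exact: mass_cts prof _ Ycc. Qed.

Lemma pressure_cts : {within `[0, Y], continuous pressure}.
Proof.
apply: within_mul; first exact: within_cst.
apply: (@within_comp_at R _ rho (fun z => z `^ gamma)) => // y.
rewrite /= in_itv/= => yY.
exact: is_derive_cts (is_derive1_powR gamma (rho_pos yY)).
Qed.

Lemma weight_cts : {within `[0, Y], continuous weight}.
Proof. by apply: within_mul => //; apply: within_exp; exact: within_id. Qed.

Lemma potential_cts : {within `[0, Y], continuous potential}.
Proof.
apply: (@within_comp R _ _ (fun z => - z)); first by move=> z; exact: opp_continuous.
apply: within_mul; first exact: within_cst.
by apply: within_mul => //; apply: within_mul => //; exact: within_id.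
Qed.

Lemma pressure_ge y : 0 <= y <= Y -> pressure Y <= pressure y.
Proof.
move=> yY; have /andP[y0 yY'] := yY.
apply: ler_wpM2l; first exact: ltW.
have rYy : rho Y <= rho y by apply: (rho_decr gamma1 prof).
by apply: ge0_ler_powR; rewrite ?nnegrE// ltW// rho_pos// lexx ltW.
Qed.

Lemma pressure_gt0 y : 0 <= y <= Y -> 0 < pressure y.
Proof. by move=> yY; rewrite mulr_gt0// powR_gt0// rho_pos. Qed.

Let rho_le y : 0 <= y <= Y -> rho y <= rho0.
Proof.
move=> /[dup] yY /andP[y0 _]; rewrite -(rho_at0 prof).
by apply: (rho_decr gamma1 prof) => //; case/andP: (in_Rg0 yY).
Qed.

Let rho00 : 0 < rho0.
Proof. by rewrite -(rho_at0 prof) rho_pos// lexx ltW. Qed.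

Let Mc : R := 4 * pi * rho0 / d%:R.
Let Mc0 : 0 <= Mc.
Proof.
by rewrite /Mc mulr_ge0 ?invr_ge0 ?ler0n// mulr_ge0 ?(ltW rho00)// mulr_ge0// pi_ge0.
Qed.
Let m_le y : 0 <= y <= Y -> m y <= Mc * y ^+ d.
Proof.
move=> yY; have := mass_le gamma1 prof (in_Rg0 yY).
by rewrite /Mc -/d mulrA [_ / d%:R]mulrAC.
Qed.
Let m_ge0 y : 0 <= y <= Y -> 0 <= m y.
Proof.
move=> /andP[]; rewrite le_eqVlt => /predU1P[<- _|y0 yY]; first by rewrite mass0.
by apply/ltW/(mass_gt0 prof)/in_Rg; rewrite y0.
Qed.

Lemma weight_le y : 0 <= y <= Y -> `|weight y| <= rho0 * y ^+ n.
Proof.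
move=> yY; have /andP[y0 _] := yY.
rewrite ger0_norm; last by rewrite mulr_ge0 ?exprn_ge0// ltW// rho_pos.
by rewrite /weight mulrC; apply: ler_wpM2r; [exact: exprn_ge0|exact: rho_le].
Qed.

Let rm_le y : 0 <= y <= Y -> y * rho y * m y <= Mc * (y ^+ n * rho y).
Proof.
move=> yY; have /andP[y0 _] := yY.
rewrite (_ : Mc * _ = y * rho y * (Mc * y ^+ d)); last by rewrite /n /d !exprS; ring.
apply: ler_wpM2l; last exact: m_le.
by apply: mulr_ge0 => //; exact/ltW/rho_pos.
Qed.

Lemma potential_le y : 0 <= y <= Y -> `|potential y| <= cpl * Mc * rho0 * y ^+ n.
Proof.
move=> yY; have /andP[y0 _] := yY; have r0 := ltW (rho_pos yY).
have q0 : 0 <= y * rho y * m y by rewrite mulr_ge0 ?m_ge0// mulr_ge0.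
rewrite normrN ger0_norm; last by rewrite mulr_ge0// ltW.
rewrite (_ : _ * y ^+ n = cpl * (Mc * (rho0 * y ^+ n))); last by ring.
apply: ler_wpM2l; first exact: ltW.
apply: le_trans (rm_le yY) _; apply: ler_wpM2l => //.
by rewrite mulrC; apply: ler_wpM2r; [exact: exprn_ge0|exact: rho_le].
Qed.

(** By [m <= Mc * y ^+ d], [- potential] is at most [cpl * Mc] times [weight]; the 1 makes the value
    positive. *)
Definition mu_top : R := cpl * Mc + 1.

Lemma mu_top_gt0 : 0 < mu_top.
Proof. by rewrite ltr_wpDl// mulr_ge0// ltW. Qed.

Lemma top_ge0 y : 0 <= y <= Y -> 0 <= mu_top * weight y + potential y.
Proof.
move=> yY; have /andP[y0 _] := yY; have r0 := ltW (rho_pos yY).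
have w0 : 0 <= weight y by rewrite mulr_ge0 ?exprn_ge0.
rewrite /potential subr_ge0.
rewrite (_ : mu_top * weight y = cpl * (Mc * (y ^+ n * rho y)) + weight y); last first.
  by rewrite /mu_top /weight; ring.
apply: ler_wpDr => //; apply: ler_wpM2l; [exact: ltW|exact: rm_le].
Qed.

Lemma weight_gt0 y : 0 < y < Y -> 0 < weight y.
Proof. by move=> /andP[y0 yY]; rewrite mulr_gt0 ?exprn_gt0// rho_pos// !ltW. Qed.

(* The derivative of the profile along its scaling family, normalised to 1 at the
   centre (where the formula for [hU] is the junk value 0), and its flux. *)
Definition chi0 y : R := if y == 0 then 1 else d%:R / x * (1 - Us / U y).
Definition om0 y : R := d%:R / x * (pressure y * y ^+ d * (Us * (d%:R - V y - U y) / U y)).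

Let dx0 : 0 < d%:R / x.
Proof. by rewrite divr_gt0// ltr0n. Qed.

Let Upos y : 0 < y <= Y -> 0 < U y.
Proof. by move=> yY; apply: (hU_gt0 prof); exact: in_Rg. Qed.

Let U_lower y : 0 < y <= Y -> d%:R * rho y / rho0 <= U y.
Proof.
move=> yY; have /andP[y0 yY'] := yY; have yY0 : 0 <= y <= Y by rewrite yY' ltW.
rewrite ler_pdivrMr// /hU mulrAC ler_pdivlMr; last exact: (mass_gt0 prof (in_Rg yY)).
have d0 : 0 < d%:R :> R by rewrite ltr0n.
rewrite (_ : _ * rho0 = d%:R * rho y * (Mc * y ^+ d)); last first.
  by rewrite /Mc -/d; field; exact: lt0r_neq0.
by apply: ler_wpM2l; [rewrite mulr_ge0// ltW// rho_pos|exact: m_le].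
Qed.

Lemma is_derive_pressure y : 0 < y < Rg ->
  is_derive y 1 pressure (- (gamma * pressure y * V y / y)).
Proof.
move=> yR; have /andP[y0 yR'] := yR.
have h := is_derive_fmul (is_derive_const gamma y) (is_derive_rhog prof yR).
apply: is_derive_eq; rewrite /pressure mul0r add0r /hV exprS.
have r := rho_powV prof (y := y); rewrite yR' ltW// in r; rewrite -{1}(r isT).
by field; rewrite (lt0r_neq0 y0) (lt0r_neq0 gamma0) lt0r_neq0// exprn_gt0.
Qed.

Lemma is_derive_chi0 y : 0 < y < Rg ->
  is_derive y 1 chi0 (om0 y / (pressure y * y ^+ n)).
Proof.
move=> yR; have /andP[y0 yR'] := yR.
have u0 : U y != 0 := lt0r_neq0 (hU_gt0 prof yR).
have h1 := is_derive_fmul (is_derive_const Us y) (is_derive_finv u0 (is_derive_hU gamma1 prof yR)).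
have h2 := is_derive_fadd (is_derive_const 1 y) (is_derive_fopp h1).
have h3 := is_derive_fmul (is_derive_const (d%:R / x) y) h2.
have h : is_derive y 1 (fun z => d%:R / x * (1 - Us / U z)) (om0 y / (pressure y * y ^+ n)).
  have P0 : pressure y != 0.
    by rewrite lt0r_neq0// mulr_gt0// powR_gt0// (rho_gt0 prof)// yR' ltW.
  apply: is_derive_eq; rewrite /om0 -/d /n [y ^+ k.+3]exprS -/d.
  have yd : y ^+ d != 0 by rewrite lt0r_neq0// exprn_gt0.
  move: (pressure y) (U y) (V y) (y ^+ d) P0 u0 yd (lt0r_neq0 y0) (lt0r_neq0 x0).
  by move: (d%:R) => D P u v E P0 u0 E0 y0' x0'; field; rewrite P0 u0 E0 y0' x0'.
apply: near_eq_is_derive h; apply: (near_interval yR) => z /andP[z0 _].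
by rewrite /chi0 gt_eqF.
Qed.

(** The scaling symmetry at work: the identity rests on gamma = 2 - 2 / x and [cplE]. *)
Lemma is_derive_om0 y : 0 < y < Rg -> is_derive y 1 om0 (potential y * chi0 y).
Proof.
move=> yR; have /andP[y0 yR'] := yR.
have u0 : U y != 0 := lt0r_neq0 (hU_gt0 prof yR).
have hU' := is_derive_hU gamma1 prof yR; have hV' := is_derive_hV gamma1 prof yR.
have h1 := is_derive_fadd (is_derive_fadd (is_derive_const (d%:R) y) (is_derive_fopp hV'))
  (is_derive_fopp hU').
have h2 := is_derive_fmul (is_derive_fmul (is_derive_const Us y) h1) (is_derive_finv u0 hU').
have h3 := is_derive_fmul (is_derive_fmul (is_derive_pressure yR)
  (is_derive_pow d (lt0r_neq0 y0))) h2.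
have h4 := is_derive_fmul (is_derive_const (d%:R / x) y) h3.
apply: is_derive_eq.
have -> : potential y = - (cpl * (pressure y * V y * y ^+ d / y)).
  have yk : y ^+ k != 0 by rewrite lt0r_neq0// exprn_gt0.
  have yRcc : 0 <= y < Rg by rewrite yR' ltW.
  move: (rho_powV prof yRcc); rewrite /potential /pressure /hV /d !exprS.
  move: (rho y) (rho y `^ (1 - gamma)) (rho y `^ gamma) (m y) (y ^+ k) yk => r w P M E E0 <-.
  by field; rewrite (lt0r_neq0 gamma0) E0 lt0r_neq0.
rewrite /chi0 gt_eqF// cplE -/d.
have -> : Us = k%:R + 2 - x by rewrite /Us dE.
have gE : gamma = 2 - 2 / x.
  by apply: (mulIf (lt0r_neq0 x0)); rewrite gx mulrBl divfK ?lt0r_neq0.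
rewrite dE gE.
move: (pressure y) (U y) (V y) (y ^+ d) u0 (lt0r_neq0 y0) (lt0r_neq0 x0).
by move: (k%:R) => D P u v E u0 y0' x0'; field; rewrite u0 y0' x0'.
Qed.

(** [U] is pinched between d rho / rho0 and d, so [chi0 - 1], which is - (Us / x) (d / U - 1), is
    controlled by [rho0 - rho y]. *)
Lemma chi0_cts : {within `[0, Y], continuous chi0}.
Proof.
have rY : 0 < rho Y by rewrite rho_pos// lexx ltW.
apply: (@within_squeeze0 R chi0 (fun y => Us / x / rho Y * (rho0 - rho y)) Y Y0).
- by move=> y /in_Rg yR; exact: is_derive_cts (is_derive_chi0 yR).
- by apply: within_mul; [exact: within_cst|apply: within_sub => //; exact: within_cst].
- by rewrite (rho_at0 prof) subrr mulr0.
move=> y yY; have /andP[y0 yY'] := yY; have u0 := Upos yY.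
have yY0 : 0 <= y <= Y by rewrite yY' ltW.
have ry := rho_pos yY0; have d0 : 0 < d%:R :> R by rewrite ltr0n.
have rYy : rho Y <= rho y by apply: (rho_decr gamma1 prof) => //; exact: ltW.
have u_le : U y <= d%:R := hU_le gamma1 prof (in_Rg yY).
rewrite {2}/chi0 eqxx /chi0 gt_eqF//.
rewrite (_ : _ - 1 = - (Us / x * (d%:R / U y - 1))); last first.
  move: u0; rewrite /Us; move: (U y) (d%:R) => u D u0.
  by field; rewrite !lt0r_neq0.
have h1 : 1 <= d%:R / U y by rewrite ler_pdivlMr// mul1r.
have ux : 0 < Us / x by rewrite divr_gt0.
rewrite normrN ger0_norm; last by rewrite mulr_ge0// ?subr_ge0// ltW.
rewrite -!mulrA; apply: ler_wpM2l; first exact: ltW.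
apply: ler_wpM2l; first by rewrite invr_ge0 ltW.
apply: le_trans (_ : (rho y)^-1 * (rho0 - rho y) <= _); last first.
  apply: ler_wpM2r; first by rewrite subr_ge0 rho_le.
  by rewrite lef_pV2.
rewrite mulrBr mulVf ?lt0r_neq0// lerD2r [X in _ <= X]mulrC.
rewrite ler_pdivrMr// mulrAC ler_pdivlMr// [X in _ <= X]mulrC -ler_pdivrMr//.
exact: U_lower.
Qed.

Lemma om0_cts : {within `[0, Y], continuous om0}.
Proof.
have rY : 0 < rho Y by rewrite rho_pos// lexx ltW.
have d0 : 0 < d%:R :> R by rewrite ltr0n.
have [C C0 hC] := hV_small gamma1 Rg0 prof Ycc.
pose L := d%:R * rho Y / rho0.
have L0 : 0 < L by rewrite divr_gt0// mulr_gt0.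
pose B := d%:R / x * (gamma * rho0 `^ gamma * (Us * (d%:R + C * Y ^+ 2 + d%:R) / L)).
apply: (@within_squeeze0 R om0 (fun y => B * y ^+ d) Y Y0).
- by move=> y /in_Rg yR; exact: is_derive_cts (is_derive_om0 yR).
- by apply: within_mul; [exact: within_cst|apply: within_exp; exact: within_id].
- by rewrite expr0n/= mulr0.
move=> y yY; have /andP[y0 yY'] := yY; have u0 := Upos yY.
have yY0 : 0 <= y <= Y by rewrite yY' ltW.
have ry := rho_pos yY0; have v0 : 0 < V y := hV_gt0 gamma1 prof (in_Rg yY).
have rYy : rho Y <= rho y by apply: (rho_decr gamma1 prof) => //; exact: ltW.
have u_le : U y <= d%:R := hU_le gamma1 prof (in_Rg yY).
have L_le : L <= U y.
  apply: le_trans (U_lower yY); apply: ler_wpM2r; first by rewrite invr_ge0 ltW.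
  by apply: ler_wpM2l => //; exact: ltW.
have v_le : V y <= C * Y ^+ 2.
  by apply: le_trans (hC y yY) _; apply: ler_wpM2l => //; apply: lerXn2r; rewrite ?nnegrE// ltW.
have -> : om0 0 = 0 by rewrite /om0 expr0n/= mulr0 mul0r mulr0.
have yd : 0 <= y ^+ d by rewrite exprn_ge0// ltW.
have P0 := pressure_gt0 yY0.
rewrite subr0 /om0 (_ : B * _ = d%:R / x * (gamma * rho0 `^ gamma * y ^+ d *
  (Us * (d%:R + C * Y ^+ 2 + d%:R) / L))); last by rewrite /B; ring.
rewrite normrM (gtr0_norm dx0); apply: ler_wpM2l; first exact: ltW.
rewrite normrM ger0_norm; last by rewrite mulr_ge0// ltW.
apply: ler_pM => //; first by rewrite mulr_ge0// ltW.
  apply: ler_wpM2r => //; apply: ler_wpM2l; first exact: ltW.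
  by apply: ge0_ler_powR; [exact: ltW|rewrite nnegrE ltW|rewrite nnegrE ltW|exact: rho_le].
rewrite normrM normfV (gtr0_norm u0); apply: ler_pM => //.
- by rewrite invr_ge0 ltW.
- rewrite normrM (gtr0_norm Us0); apply: ler_wpM2l; first exact: ltW.
  move: u_le v_le (ltW u0) (ltW v0) (ltW d0) (mulr_ge0 C0 (exprn_ge0 2 (ltW Y0))).
  move: (U y) (V y) (d%:R) (C * Y ^+ 2) => u v D W *.
  by rewrite ler_norml; apply/andP; split; lra.
- by rewrite lef_pV2.
Qed.

(** d chi + y chi' is, up to sign, the Lagrangian change of ln rho; for the scaling family the
    Eulerian change x - V and the transport term combine to x - Us V / U. *)
Lemma boundary_form_chi0 :
  boundary_form n Rad d%:R pressure chi0 om0 = d%:R / x * (x - Us * V Rad / U Rad).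
Proof.
have RY : 0 < Rad <= Y by rewrite Rad0 ltW.
have u0 := lt0r_neq0 (Upos RY).
have P0 : pressure Rad != 0 by apply/lt0r_neq0/pressure_gt0; rewrite !ltW.
have yd : Rad ^+ d != 0 by rewrite lt0r_neq0// exprn_gt0.
rewrite /boundary_form /chi0 gt_eqF// /om0 /n exprS -/d.
have -> : x - Us * V Rad / U Rad = d%:R - Us - Us * V Rad / U Rad by rewrite /Us; ring.
move: (pressure Rad) (U Rad) (V Rad) (Rad ^+ d) P0 u0 yd (lt0r_neq0 Rad0) (lt0r_neq0 x0).
by move: (d%:R) => D P u v E P0 u0 E0 y0' x0'; field; rewrite P0 u0 E0 y0' x0'.
Qed.

Lemma neutral_sol : spectral_sol n Y pressure weight potential 0 chi0 om0.
Proof.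
split.
- by split; [exact: chi0_cts|exact: om0_cts].
- by rewrite /chi0 eqxx /om0 expr0n/= mulr0 mul0r mulr0; split.
- by move=> y /in_Rg_oo; exact: is_derive_chi0.
- by move=> y yY; rewrite mul0r add0r; apply: is_derive_om0; exact: in_Rg_oo.
Qed.

Hypothesis certificate :
  (exists2 y, 0 < y <= Rad & U y < Us) \/ x * U Rad < Us * V Rad.

Lemma unstable_flux_sol : exists mu chi om, [/\ 0 < mu,
  spectral_sol n Y pressure weight potential mu chi om &
  boundary_form n Rad d%:R pressure chi om = 0].
Proof.
have d0 : 0 < d%:R :> R by rewrite ltr0n.
have YY : 0 <= Y <= Y by rewrite lexx ltW.
have B0 : 0 <= cpl * Mc * rho0.
  by apply: mulr_ge0; [apply: mulr_ge0 => //|]; exact: ltW.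
apply: (@shooting R n Y Rad d%:R (pressure Y) rho0 (cpl * Mc * rho0) mu_top
  pressure weight potential Rad0 RadY d0 (pressure_gt0 YY) (ltW rho00) B0 mu_top_gt0
  pressure_cts weight_cts potential_cts pressure_ge weight_le potential_le weight_gt0
  top_ge0 chi0 om0 neutral_sol).
have RY : 0 < Rad <= Y by rewrite Rad0 ltW.
case: certificate => [[y yR Uy]|h].
  left; exists y => //; have /andP[y0 yR'] := yR.
  rewrite /chi0 gt_eqF// pmulr_rlt0// subr_lt0 ltr_pdivlMr ?mul1r//.
  by apply: Upos; rewrite y0 (le_trans yR')// ltW.
right; rewrite boundary_form_chi0 pmulr_rlt0// subr_lt0 ltr_pdivlMr//.
exact: Upos.
Qed.

(** * From flux solutions to growing modes *)

Section GrowingMode.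
Variables (mu : R) (chi om : R -> R).
Hypotheses (mu0 : 0 < mu) (sol : spectral_sol n Y pressure weight potential mu chi om).
Hypothesis bc : boundary_form n Rad d%:R pressure chi om = 0.

Let slope y := om y / (pressure y * y ^+ n).
Let slope' y :=
  ((mu * weight y + potential y) * chi y - om y * (n%:R - gamma * V y) / y)
  / (pressure y * y ^+ n).

Let dchi y : 0 < y < Y -> is_derive y 1 chi (slope y).
Proof. by case: sol => _ _ h _; exact: h. Qed.

Let dom y : 0 < y < Y -> is_derive y 1 om ((mu * weight y + potential y) * chi y).
Proof. by case: sol => _ _ _; apply. Qed.

Let pn_gt0 y : 0 < y <= Y -> 0 < pressure y * y ^+ n.
Proof.
move=> /andP[y0 yY]; apply: mulr_gt0; last exact: exprn_gt0.
by apply: pressure_gt0; rewrite yY ltW.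
Qed.

Let dpn y : 0 < y < Y ->
  is_derive y 1 (fun z => pressure z * z ^+ n)
    (pressure y * y ^+ n * (n%:R - gamma * V y) / y).
Proof.
move=> yY; have y0 : y != 0 by case/andP: yY => /lt0r_neq0.
have h := is_derive_fmul (is_derive_pressure (in_Rg_oo yY)) (is_derive_pow n y0).
apply: is_derive_eq; move: (pressure y) (V y) (y ^+ n) (n%:R) => P v E N.
by field.
Qed.

Let dslope y : 0 < y < Y -> is_derive y 1 slope (slope' y).
Proof.
move=> yY; have /andP[y0 yY'] := yY.
have E0 : pressure y * y ^+ n != 0 by apply/lt0r_neq0/pn_gt0; rewrite y0 ltW.
have h := is_derive_fmul (dom yY)
  (is_derive_finv (f := fun z => pressure z * z ^+ n) E0 (dpn yY)).
apply: is_derive_eq; rewrite /slope'; move: (pressure y * y ^+ n) E0 => E E0.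
by field; rewrite E0 lt0r_neq0.
Qed.

Let derive1_chi y : 0 < y < Y -> derive1 chi y = slope y.
Proof. by move=> yY; rewrite derive1E; have [_ ->] := dchi yY. Qed.

Let ddchi y : 0 < y < Y -> is_derive y 1 (derive1 chi) (slope' y).
Proof.
move=> yY; apply: near_eq_is_derive (dslope yY).
by apply: (near_interval yY) => z zY; rewrite derive1_chi.
Qed.

Let cts_mul (f g : R -> R) y : {for y, continuous f} -> {for y, continuous g} ->
  {for y, continuous (fun z => f z * g z)}.
Proof. by move=> cf cg; exact: cvgM. Qed.

Let slope'_cts y : 0 < y < Y -> {for y, continuous slope'}.
Proof.
move=> yY; have yR := in_Rg_oo yY; have /andP[y0 yY'] := yY.
have E0 : pressure y * y ^+ n != 0 by apply/lt0r_neq0/pn_gt0; rewrite y0 ltW.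
have crho := is_derive_cts (is_derive_rho gamma1 prof yR).
have cm := is_derive_cts (is_derive_mass prof yR).
have cid : {for y, continuous (fun z : R => z)} by exact: cvg_id.
have ccst (e : R) : {for y, continuous (fun _ : R => e)} by exact: cvg_cst.
have cpow j : {for y, continuous (fun z : R => z ^+ j)} by exact: exprn_continuous.
apply: cts_mul; last by apply: cvgV => //; exact: is_derive_cts (dpn yY).
have c1 : {for y, continuous (fun z => (mu * weight z + potential z) * chi z)}.
  apply: cts_mul; last exact: is_derive_cts (dchi yY).
  have cw : {for y, continuous weight} := cts_mul (cpow n) crho.
  have cp : {for y, continuous (fun z => cpl * (z * rho z * m z))} :=
    cts_mul (ccst cpl) (cts_mul (cts_mul cid crho) cm).
  by apply: cvgD; [exact: (cts_mul (ccst mu) cw)|exact: cvgN cp].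
have c2 : {for y, continuous (fun z => om z * (n%:R - gamma * V z) / z)}.
  apply: cts_mul; last by apply: cvgV => //; exact: lt0r_neq0.
  apply: cts_mul; first exact: is_derive_cts (dom yY).
  apply: cvgB; first exact: ccst.
  by apply: cts_mul => //; exact: is_derive_cts (is_derive_hV gamma1 prof yR).
exact: cvgB c1 c2.
Qed.

Let in_Y y : 0 < y <= Rad -> 0 < y < Y.
Proof. by move=> /andP[-> h]; exact: le_lt_trans RadY. Qed.

Let C2_chi : C2_on_0R Rad chi.
Proof.
split=> [y /in_Y yY|].
  by split; [case: (dchi yY)|case: (ddchi yY)].
apply: continuous_in_subspaceT => y; rewrite inE/= in_itv/= => /in_Y yY.
have E z : 0 < z < Y -> slope' z = derive1 (derive1 chi) z.
  by move=> zY; rewrite [RHS]derive1E; have [_ ->] := ddchi zY.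
rewrite /continuous_at -E//; apply: cvg_trans (slope'_cts yY).
by apply: near_eq_cvg; apply: (near_interval yY).
Qed.

Let L_chi y : 0 < y <= Rad ->
  LE_L d gamma rho chi y = - Num.sqrt mu ^+ 2 * y ^+ d.+1 * rho y * chi y.
Proof.
move=> yR; have yY := in_Y yR; have yRg := in_Rg_oo yY; have /andP[y0 _] := yR.
rewrite sqr_sqrtr ?ltW// /LE_L.
have h : is_derive y 1 (fun z => rho z `^ gamma * z ^+ d.+1 * derive1 chi z)
    (gamma^-1 * ((mu * weight y + potential y) * chi y)).
  have h1 := is_derive_fmul (is_derive_const gamma^-1 y) (dom yY).
  have h2 : is_derive y 1 (fun z => gamma^-1 * om z)
      (gamma^-1 * ((mu * weight y + potential y) * chi y)).
    by apply: is_derive_eq; rewrite mul0r add0r.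
  apply: near_eq_is_derive h2; apply: (near_interval yY) => z zY.
  rewrite derive1_chi// /slope.
  have /andP[z0 zY'] := zY.
  have P0 : rho z `^ gamma != 0 by rewrite lt0r_neq0// powR_gt0// rho_pos// !ltW.
  rewrite /pressure /n -/d; field.
  by rewrite P0 (lt0r_neq0 gamma0) lt0r_neq0// exprn_gt0.
have -> : derive1 (fun z => rho z `^ gamma * z ^+ d.+1 * derive1 chi z) y =
    gamma^-1 * ((mu * weight y + potential y) * chi y).
  by rewrite derive1E; have [_ ->] := h.
have -> : derive1 (fun z => rho z `^ gamma) y = - (rho y * m y) / y ^+ k.+1.
  by rewrite derive1E; have [_ ->] := is_derive_rhog prof yRg.
rewrite -/cpl /weight /potential /n /d !exprS.
have yk : y ^+ k != 0 by rewrite lt0r_neq0// exprn_gt0.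
move: (rho y) (m y) (chi y) (y ^+ k) yk cpl (lt0r_neq0 gamma0) (lt0r_neq0 y0) => r M X E E0 c g0 y0'.
by field; rewrite g0 E0 y0'.
Qed.

(** [chi] is bounded and, its flux being O(y^(n+1)), so is chi'; a constant then dominates the
    integrand. *)
Let H1_chi : H1r_of_C1 d Rad chi.
Proof.
have [[cchi com] [chi_0 om_0] _ _] := sol.
have RadRcc y : 0 < y <= Rad -> 0 <= y <= Y.
  by move=> /in_Y/andP[y0 yY]; rewrite !ltW.
have [X X0 hX] := within_bounded (ltW Y0) cchi.
have [K K0 hK] : exists2 K : R, 0 <= K &
    forall y, 0 <= y <= Y -> `|mu * weight y + potential y| <= K * y ^+ n.
  exists (mu * rho0 + cpl * Mc * rho0).
    apply: addr_ge0; apply: mulr_ge0; try exact: ltW.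
    by apply: mulr_ge0; [exact: ltW|].
  move=> y yY; apply: le_trans (ler_normD _ _) _; rewrite mulrDl; apply: lerD.
    by rewrite normrM (gtr0_norm mu0) -mulrA; apply: ler_wpM2l; [exact: ltW|exact: weight_le].
  exact: potential_le.
have YY : 0 <= Y <= Y by rewrite lexx ltW.
have hom y : 0 <= y <= Y -> `|om y| <= y ^+ n * (K * X * y).
  move=> yY; have KX : 0 <= K * X by exact: mulr_ge0.
  have := @flux_bound R n Y (pressure Y) 0 (pressure_gt0 YY) om
    (fun y => (mu * weight y + potential y) * chi y) 0 (K * X) (lexx _) KX com om_0 dom.
  move=> H; have := H _ y yY; rewrite !mul0r add0r; apply.
  move=> z /andP[z0 zY]; rewrite !mul0r add0r normrM mulrA [_ * K]mulrC.
  by apply: ler_pM => //; [apply: hK|apply: hX]; rewrite !ltW.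
pose S := K * X * Y / pressure Y.
have hslope y : 0 < y <= Rad -> `|slope y| <= S.
  move=> yR; have yY := RadRcc y yR; have /andP[y0 _] := yR; have /andP[_ yY'] := yY.
  have pn : 0 < pressure y * y ^+ n by apply: pn_gt0; rewrite y0.
  rewrite /slope normrM normfV (gtr0_norm pn) ler_pdivrMr//.
  apply: le_trans (hom y yY) _; rewrite mulrC [X in _ <= X]mulrA.
  apply: ler_wpM2r; first exact/exprn_ge0/ltW.
  have KX : 0 <= K * X by exact: mulr_ge0.
  apply: le_trans (_ : K * X * Y <= _); first exact: ler_wpM2l.
  rewrite /S -[X in X <= _](divfK (lt0r_neq0 (pressure_gt0 YY))).
  apply: ler_wpM2l; last exact: pressure_ge.
  by apply: divr_ge0; [apply: mulr_ge0 => //; exact: ltW|exact/ltW/pressure_gt0].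
have setE : [set y : R | 0 < y <= Rad] = `]0, Rad]%classic.
  by apply/seteqP; split=> y; rewrite /= in_itv.
rewrite /H1r_of_C1 setE.
pose B := Y ^+ n * (X ^+ 2 + S ^+ 2).
have mD : measurable (`]0, Rad]%classic : set R) by exact: measurable_itv.
apply: (@le_lt_trans _ _ (\int[@lebesgue_measure R]_(y in `]0%R, Rad]) (cst B%:E) y)%E).
  apply: ge0_le_integral => //.
  - move=> y; rewrite /= in_itv/= => /andP[y0 _]; rewrite lee_fin; apply: mulr_ge0.
      exact/exprn_ge0/ltW.
    by apply: addr_ge0; exact: sqr_ge0.
  - apply/measurable_EFinP; apply: subspace_continuous_measurable_fun => //.
    have sub : {within `]0, Rad], continuous chi}.
      apply: continuous_subspaceW cchi => y /=; rewrite !in_itv/= => /RadRcc.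
      by [].
    have dc : {within `]0, Rad], continuous (derive1 chi)}.
      apply: continuous_in_subspaceT => y; rewrite inE/= in_itv/= => /in_Y yY.
      exact: is_derive_cts (ddchi yY).
    apply: within_mul; first by apply: within_exp; exact: within_id.
    by apply: within_add; apply: within_exp.
  - move=> y; rewrite /= in_itv/= => yR; rewrite lee_fin.
    have yY := RadRcc y yR; have /andP[y0 yY'] := yY.
    apply: ler_pM.
    + exact: exprn_ge0.
    + by apply: addr_ge0; exact: sqr_ge0.
    + by apply: lerXn2r; rewrite ?nnegrE// ltW.
    + rewrite derive1_chi ?in_Y//; apply: lerD.
        by rewrite -real_normK ?num_real//; apply: lerXn2r; rewrite ?nnegrE//; exact: hX.
      rewrite -real_normK ?num_real//; apply: lerXn2r; rewrite ?nnegrE//; last exact: hslope.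
      exact: le_trans (hslope y yR).
have muE : @lebesgue_measure R `]0, Rad]%classic = Rad%:E.
  by rewrite lebesgue_measure_itv/= lte_fin Rad0 oppr0 adde0.
rewrite integral_cst// (_ : (B%:E * _ = (B * Rad)%:E)%E) ?ltry//.
by rewrite (EFinM B Rad) -muE.
Qed.

Lemma growing_mode_sqrt : growing_mode d gamma rho Rad (Num.sqrt mu) chi.
Proof.
have RY := in_Y (introT andP (conj Rad0 (lexx Rad))).
split; first by rewrite sqrtr_gt0.
split=> //.
(* A nonzero value is asked for at some [y > 0], whereas [chi 0 = 1]; continuity moves off the
   centre. *)
- have [[cchi _] [chi_0 _] _ _] := sol.
  have c1 : [set z | 0 < z] (chi 0) by rewrite /= chi_0.
  have [s /andP[s0 _] hs] := within_near0 Y0 cchi (@open_gt R 0) c1.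
  exists (Num.min (s / 2) Rad); rewrite lt_min Rad0 ge_min lexx orbT divr_gt0//.
  split => //; apply/lt0r_neq0/hs; rewrite lt_min Rad0 divr_gt0//= gt_min.
  by apply/orP; left; lra.
- by move: bc; rewrite /boundary_form derive1_chi.
Qed.

End GrowingMode.

Lemma unstable_of_certificate : linearly_unstable d gamma rho Rad.
Proof.
have [mu [chi [om [mu0 sol bc]]]] := unstable_flux_sol.
by exists (Num.sqrt mu), chi; exact: growing_mode_sqrt mu0 sol bc.
Qed.

End Star.

Theorem theorem1p1 (R : realType) (d : nat) (gamma : R) :
  (3 <= d)%N -> (d < 10)%N ->
  1 <= gamma -> gamma < 2 -> gamma < 2 * (d%:R - 1) / d%:R ->
  exists C : R, 0 < C /\
    forall (rho0 : R) (rho : R -> R) (Rad : R),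
      C < rho0 -> LE_liquid_star d gamma rho0 rho Rad ->
      linearly_unstable d gamma rho Rad.
Proof.
move=> d3 d10 g1 g2 gd.
have dR : (0 : R) < d%:R by rewrite ltr0n (leq_trans _ d3).
have D3 : 3 <= d%:R :> R by rewrite (ler_nat R 3 d).
have D10 : d%:R < 10 :> R by rewrite (ltr_nat R d 10).
have g20 : 0 < 2 - gamma by rewrite subr_gt0.
(* In terms of [x], gamma >= 1 becomes x >= 2 and gamma < 2 (d - 1) / d becomes x < d. *)
pose x := 2 / (2 - gamma).
have x0 : 0 < x by rewrite divr_gt0.
have gx : gamma * x = 2 * x - 2 by rewrite /x; field; exact: lt0r_neq0.
have x2 : 2 <= x by rewrite /x ler_pdivlMr//; lra.
have xd : x < d%:R.
  rewrite /x ltr_pdivrMr//; move: gd; rewrite ltr_pdivlMr//.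
  by move: (d%:R) => D; lra.
clearbody x.
have g12 : 1 <= gamma < 2 by rewrite g1.
have [K [c [K0 c0 lyap]]] := lyapunov_form_pos (x / (d%:R - x)) D3 D10 x2 xd gx g12.
exists (expR ((1 + x / (d%:R - x) + K * x) / c)); split; first exact: expR_gt0.
move=> rho0 rho Rad hC [Rad0 [Rg [RadRg prof rho_end]]].
case: d d3 d10 gd dR D3 D10 xd lyap hC prof => [//|[//|k]] d3 d10 gd dR D3 D10 xd lyap hC prof.
(* A growing mode needs two-sided derivatives at [Rad], so the radial equation is solved on a longer
   interval. *)
pose Y := (Rad + Rg) / 2.
have RadY : Rad < Y by rewrite /Y; lra.
have YRg : Y < Rg by rewrite /Y; lra.
apply: (unstable_of_certificate g1 g2 x0 xd gx Rad0 RadY YRg prof).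
apply: contrapT => /not_orP[noU noV].
have U_ge y : 0 < y <= Rad -> k.+2%:R - x <= hU k rho y.
  by move=> yR; rewrite leNgt; apply/negP => h; apply: noU; exists y.
have V_le : (k.+2%:R - x) * hV k gamma rho Rad <= x * hU k rho Rad.
  by rewrite leNgt; apply/negP.
have := central_density_le g1 g2 x2 xd gx Rad0 RadRg prof K0 c0 lyap U_ge V_le rho_end.
by rewrite leNgt hC.
Qed.
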